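(* Let $0<\alpha_1,\alpha_2\leq 1$ and $\theta=\frac{\alpha_2-\alpha_1}{\alpha_2+\alpha_1}$. Let $f(z)=z+\sum_{n=2}^\infty a_nz^n$ belong to $\mathcal{S}^*_t(\alpha_1,\alpha_2)$. Then $|a_2|\leq(\alpha_1+\alpha_2)\cos\frac{\theta}{2}$, and for $n=3,4,\ldots$, $$|a_n|\leq\frac{\alpha_1+\alpha_2}{n-1}\cos\frac{\theta}{2}\prod_{k=2}^{n-1}\left(1+\frac{\alpha_1+\alpha_2}{k-1}\cos\frac{\theta}{2}\right).$$
   Context: $\Delta=\{z\in\mathbb{C}:|z|<1\}$. $\mathcal{S}^*_t(\alpha_1,\alpha_2)$ denotes the class of functions $f$ analytic in $\Delta$ with $f(0)=0=f'(0)-1$ satisfying $-\frac{\pi\alpha_1}{2}<\arg\left\{\frac{zf'(z)}{f(z)}\right\}<\frac{\pi\alpha_2}{2}$ for all $z\in\Delta$. *)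

(* Defs.v *)
From Stdlib Require Import Reals.
From Coquelicot Require Import Coquelicot.
Open Scope R_scope.

Definition in_Delta (z : C) : Prop := Cmod z < 1.

Definition is_Arg (w : C) (t : R) : Prop :=
  w <> 0%C /\ -PI < t <= PI /\ w = (RtoC (Cmod w) * (cos t, sin t))%C.

Definition analytic_in_Delta (f : C -> C) : Prop :=
  forall z : C, in_Delta z -> ex_derive (K := C_AbsRing) (V := C_NormedModule) f (z : C_AbsRing).

(* The class S*_t(alpha1, alpha2): f analytic in Delta, f(0) = 0, f'(0) = 1,
   and -pi alpha1/2 < arg (z f'(z)/f(z)) < pi alpha2/2 for all z in Delta.
   At z = 0 the quotient z f'(z)/f(z) is understood as its limit f'(0) = 1
   (argument 0), so the condition is imposed for z <> 0, where f(z) <> 0 is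
   required for the quotient (and its argument) to be defined. *)
Definition S_star_t (alpha1 alpha2 : R) (f : C -> C) : Prop :=
  analytic_in_Delta f /\
  f 0%C = 0%C /\
  is_derive (K := C_AbsRing) (V := C_NormedModule) f (RtoC 0 : C_AbsRing) (RtoC 1 : C_NormedModule) /\
  forall z : C, in_Delta z -> z <> 0%C ->
    f z <> 0%C /\
    forall d : C, is_derive (K := C_AbsRing) (V := C_NormedModule) f (z : C_AbsRing) (d : C_NormedModule) ->
      exists t : R, is_Arg (z * d / f z)%C t /\
        - (PI * alpha1 / 2) < t < PI * alpha2 / 2.

Fixpoint prod_from (g : nat -> R) (m len : nat) : R :=
  match len with
  | O => 1
  | S l => g m * prod_from g (S m) l
  end.

(* Main.v *)
(** The quotient p = z f'/f = f'/g, with g = f/z, is holomorphic on the disc and takes values in the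
    sector -A1 < arg < A2, where Ai = pi alpha_i / 2.  Its Taylor coefficients p_n come from long
    division of power series, and comparing coefficients in z f' = p f gives
    m a_(m+1) = p_1 a_m + ... + p_m a_1.  So everything reduces to Rogosinski's bound
    |p_n| <= (alpha1 + alpha2) cos (pi theta / 2) for n >= 1.

    Averaging p over the rotations by n-th roots of unity yields Q = 1 + p_n z^n + ..., which stays in the
    sector because the sector is convex.  The power G = Q^beta, beta = pi / (A1 + A2), lies in a half-plane
    bisected by exp (i phi), phi = pi theta / 2, so S = (G - 1) / (G + exp (2 i phi)) is bounded by 1
    and S / z^n tends to beta p_n / (1 + exp (2 i phi)) at the origin.  By the mean value property this limit
    has modulus at most 1, and |1 + exp (2 i phi)| = 2 cos phi.

    The mean value property is obtained without Cauchy's theorem: in the coordinate zeta = s + i t,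
    z = exp zeta, the integral over a period of t does not depend on s, by differentiation under
    the integral sign and the Cauchy-Riemann equations. *)

Require Import Defs.
From Stdlib Require Import Reals Lra Lia.
From Coquelicot Require Import Coquelicot.
Open Scope R_scope.

(** * Complex power series *)

(** Convergence is taken coordinatewise, so that linearity, comparison and uniqueness reduce to real
    series. *)
Definition is_Cseries (u : nat -> C) (l : C) : Prop :=
  is_series (fun k => Re (u k)) (Re l) /\ is_series (fun k => Im (u k)) (Im l).

Lemma im_le_Cmod (c : C) : Rabs (Im c) <= Cmod c.
Proof. eapply Rle_trans; [apply Rmax_r | apply Rmax_Cmod]. Qed.

Lemma Cmod_le_abs (c : C) : Cmod c <= Rabs (Re c) + Rabs (Im c).
Proof.
  destruct c as [x y]; unfold Re, Im; simpl.
  replace (x, y) with (RtoC x + Ci * RtoC y)%C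
    by (apply injective_projections; simpl; ring).
  eapply Rle_trans; [apply Cmod_triangle|].
  rewrite Cmod_mult, Cmod_Ci, !Cmod_R; lra.
Qed.

Lemma is_Cseries_ext (u v : nat -> C) (l : C) :
  (forall k, u k = v k) -> is_Cseries u l -> is_Cseries v l.
Proof.
  intros H [H1 H2]; split; (eapply is_series_ext; [|eassumption]);
    intros k; simpl; now rewrite H.
Qed.

Lemma is_Cseries_plus (u v : nat -> C) (l m : C) :
  is_Cseries u l -> is_Cseries v m -> is_Cseries (fun k => u k + v k)%C (l + m)%C.
Proof. intros [H1 H2] [H3 H4]; split; now apply (is_series_plus (V := R_NormedModule)). Qed.

Lemma is_Cseries_scal (c : C) (u : nat -> C) (l : C) :
  is_Cseries u l -> is_Cseries (fun k => c * u k)%C (c * l)%C.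
Proof.
  intros [H1 H2]; split.
  - apply (is_series_minus (V := R_NormedModule) (fun k => Re c * Re (u k)) (fun k => Im c * Im (u k)));
      now apply (is_series_scal (V := R_NormedModule)).
  - apply (is_series_plus (V := R_NormedModule) (fun k => Re c * Im (u k)) (fun k => Im c * Re (u k)));
      now apply (is_series_scal (V := R_NormedModule)).
Qed.

Lemma is_Cseries_unique (u : nat -> C) (l m : C) :
  is_Cseries u l -> is_Cseries u m -> l = m.
Proof.
  intros [H1 H2] [H3 H4]; apply injective_projections.
  - change (Re l = Re m). now rewrite <- (is_series_unique _ _ H1), <- (is_series_unique _ _ H3).
  - change (Im l = Im m). now rewrite <- (is_series_unique _ _ H2), <- (is_series_unique _ _ H4).
Qed.

Lemma is_Cseries_decr_1 (u : nat -> C) (l : C) :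
  is_Cseries (fun k => u (S k)) l -> is_Cseries u (u 0%nat + l)%C.
Proof.
  intros [H1 H2]; split; apply (is_series_decr_1 (V := R_NormedModule));
    match goal with |- is_series _ ?x => set (m := x) end.
  - replace m with (Re l) by (change (Re l = Re (u 0%nat) + Re l + - Re (u 0%nat)); ring).
    exact H1.
  - replace m with (Im l) by (change (Im l = Im (u 0%nat) + Im l + - Im (u 0%nat)); ring).
    exact H2.
Qed.

Lemma ex_Cseries_abs (u : nat -> C) (v : nat -> R) :
  (forall k, Cmod (u k) <= v k) -> ex_series v ->
  is_Cseries u (Series (fun k => Re (u k)), Series (fun k => Im (u k))).
Proof.
  intros H Hv; split; apply Series_correct; apply (ex_series_le (V := R_CompleteNormedModule) _ v); trivial;
    intros n; (eapply Rle_trans; [|apply H]).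
  - apply re_le_Cmod.
  - apply im_le_Cmod.
Qed.

(** The factor 2 comes from bounding the real and imaginary parts separately. It only enters the
    constant of a quadratic remainder, where it is harmless. *)
Lemma is_Cseries_Cmod_le (u : nat -> C) (v : nat -> R) (l : C) :
  (forall k, Cmod (u k) <= v k) -> ex_series v -> is_Cseries u l ->
  Cmod l <= 2 * Series v.
Proof.
  intros H Hv [H1 H2].
  assert (A : forall (g : C -> R), (forall c, Rabs (g c) <= Cmod c) ->
            is_series (fun k => g (u k)) (g l) -> Rabs (g l) <= Series v).
  { intros g Hg Hs. rewrite <- (is_series_unique _ _ Hs).
    assert (Hg' : forall n, 0 <= Rabs (g (u n)) <= v n).
    { intros n; split; [apply Rabs_pos|]. eapply Rle_trans; [apply Hg | apply H]. }
    eapply Rle_trans; [apply Series_Rabs | now apply Series_le].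
    apply (ex_series_le (V := R_CompleteNormedModule) _ v); trivial. intros n. unfold norm; simpl. unfold abs; simpl.
    rewrite Rabs_Rabsolu. apply Hg'. }
  eapply Rle_trans; [apply Cmod_le_abs|].
  generalize (A Re re_le_Cmod H1) (A Im im_le_Cmod H2). lra.
Qed.

(** Power series whose coefficients grow subexponentially, i.e. with radius of convergence at least 1. *)
Definition subexp (b : nat -> C) : Prop :=
  forall r, 0 <= r < 1 -> exists M, forall k, Cmod (b k) * r ^ k <= M.

(** Total by means of [Series]; it is the sum of the power series once [b] is [subexp] and [z] lies
    in the open disc. *)
Definition PS (b : nat -> C) (z : C) : C :=
  (Series (fun k => Re (b k * z ^ k)%C), Series (fun k => Im (b k * z ^ k)%C)).

Definition dcoef (b : nat -> C) (k : nat) : C := (INR (S k) * b (S k))%C.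

(** The factor k is absorbed by enlarging the radius from r to q, halfway between r and 1: induction
    gives k (q - r) r^k <= q^(k+1). *)
Lemma subexp_mul_INR (b : nat -> C) : subexp b -> subexp (fun k => INR k * b k)%C.
Proof.
  intros H r Hr.
  set (q := (r + 1) / 2).
  assert (Hq : r < q < 1) by (unfold q; lra).
  destruct (H q) as [M HM]; [lra|].
  set (h := q - r).
  exists (M * (q / h)). intros k.
  rewrite Cmod_mult, Cmod_R, (Rabs_pos_eq _ (pos_INR k)).
  assert (E : INR k * h * r ^ k <= q * q ^ k).
  { assert (Hh : 0 < h) by (unfold h; lra).
    induction k as [|k IH].
    - simpl. nra.
    - rewrite S_INR. simpl.
      assert (P1 : 0 <= r ^ k) by (apply pow_le; lra).
      assert (P2 : r ^ k <= q ^ k) by (apply pow_incr; lra).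
      assert (Eq : q = r + h) by (unfold h; lra).
      assert (P3 : r * (INR k * h * r ^ k) <= r * (q * q ^ k)) by (apply Rmult_le_compat_l; lra).
      assert (P4 : h * r * r ^ k <= h * q * q ^ k) by (apply Rmult_le_compat; nra).
      replace (q * (q * q ^ k)) with (r * (q * q ^ k) + h * q * q ^ k) by (rewrite Eq; ring).
      lra. }
  assert (Hh : 0 < h) by (unfold h; lra).
  assert (E2 : INR k * r ^ k <= q / h * q ^ k).
  { apply Rmult_le_reg_l with h; trivial. replace (h * (q / h * q ^ k)) with (q * q ^ k) by (field; lra). lra. }
  specialize (HM k).
  assert (P0 := Cmod_ge_0 (b k)).
  assert (0 <= q / h) by (apply Rlt_le, Rdiv_lt_0_compat; lra).
  replace (INR k * Cmod (b k) * r ^ k) with (Cmod (b k) * (INR k * r ^ k)) by ring.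
  apply Rle_trans with (Cmod (b k) * (q / h * q ^ k)).
  - now apply Rmult_le_compat_l.
  - replace (Cmod (b k) * (q / h * q ^ k)) with (Cmod (b k) * q ^ k * (q / h)) by ring.
    now apply Rmult_le_compat_r.
Qed.

Lemma subexp_shift (b : nat -> C) : subexp b -> subexp (fun k => b (S k)).
Proof.
  intros H r Hr.
  set (q := (r + 1) / 2).
  assert (Hq : r < q < 1 /\ 0 < q) by (unfold q; lra).
  destruct (H q) as [M HM]; [lra|].
  exists (M / q). intros k.
  apply Rle_trans with (Cmod (b (S k)) * q ^ k).
  - apply Rmult_le_compat_l; [apply Cmod_ge_0 | apply pow_incr; lra].
  - apply Rmult_le_reg_r with q; [lra|]. replace (M / q * q) with M by (field; lra).
    generalize (HM (S k)); simpl; lra.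
Qed.

Lemma subexp_dcoef (b : nat -> C) : subexp b -> subexp (dcoef b).
Proof. intros H. exact (subexp_shift _ (subexp_mul_INR _ H)). Qed.

Lemma subexp_lin (b d : nat -> C) (c : C) :
  subexp b -> subexp d -> subexp (fun k => b k - c * d k)%C.
Proof.
  intros H1 H2 r Hr.
  destruct (H1 r Hr) as [M HM], (H2 r Hr) as [N HN].
  exists (M + Cmod c * N). intros k.
  assert (Cmod (b k - c * d k) <= Cmod (b k) + Cmod c * Cmod (d k)).
  { unfold Cminus. eapply Rle_trans; [apply Cmod_triangle|]. rewrite Cmod_opp, Cmod_mult; lra. }
  assert (0 <= r ^ k) by (apply pow_le; lra).
  generalize (HM k) (HN k) (Cmod_ge_0 c); intros. nra.
Qed.

(** Boundedness at an intermediate radius q gives comparison with the geometric series of ratio r /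
    q. *)
Lemma subexp_ex_series (b : nat -> C) (r : R) :
  subexp b -> 0 <= r < 1 -> ex_series (fun k => Cmod (b k) * r ^ k).
Proof.
  intros H Hr.
  set (q := (r + 1) / 2).
  assert (Hq : r < q < 1 /\ 0 < q) by (unfold q; lra).
  destruct (H q) as [M HM]; [lra|].
  apply (ex_series_le (V := R_CompleteNormedModule) _ (fun k => M * (r / q) ^ k)).
  - intros k. unfold norm; simpl; unfold abs; simpl.
    rewrite Rabs_pos_eq.
    2: apply Rmult_le_pos; [apply Cmod_ge_0 | apply pow_le; lra].
    replace (r ^ k) with (q ^ k * (r / q) ^ k).
    + rewrite <- Rmult_assoc. apply Rmult_le_compat_r; trivial.
      apply pow_le, Rdiv_le_0_compat; lra.
    + rewrite <- Rpow_mult_distr. f_equal. field; lra.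
  - apply (ex_series_scal (V := R_NormedModule)). apply ex_series_geom.
    rewrite Rabs_pos_eq; [apply -> Rdiv_lt_1; lra | apply Rdiv_le_0_compat; lra].
Qed.

Lemma PS_series (b : nat -> C) (z : C) :
  subexp b -> Cmod z < 1 -> is_Cseries (fun k => b k * z ^ k)%C (PS b z).
Proof.
  intros H Hz. apply ex_Cseries_abs with (fun k => Cmod (b k) * Cmod z ^ k).
  - intros k. rewrite Cmod_mult, Cmod_pow; lra.
  - apply subexp_ex_series; trivial. split; trivial. apply Cmod_ge_0.
Qed.

Lemma PS_shift (b : nat -> C) (z : C) :
  subexp b -> Cmod z < 1 -> PS b z = (b 0%nat + z * PS (fun k => b (S k)) z)%C.
Proof.
  intros H Hz. apply is_Cseries_unique with (1 := PS_series b z H Hz).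
  replace (b 0%nat) with (b 0%nat * z ^ 0)%C by (simpl; ring).
  apply (is_Cseries_decr_1 (fun k => b k * z ^ k)%C).
  eapply is_Cseries_ext.
  2: apply (is_Cseries_scal z), PS_series; trivial; now apply subexp_shift.
  intros k; simpl; ring.
Qed.

Lemma PS_0 (b : nat -> C) : subexp b -> PS b 0%C = b 0%nat.
Proof. intros H. rewrite (PS_shift b _ H); [ring | rewrite Cmod_0; lra]. Qed.

Lemma PS_lin (b d : nat -> C) (c z : C) :
  subexp b -> subexp d -> Cmod z < 1 ->
  PS (fun k => b k - c * d k)%C z = (PS b z - c * PS d z)%C.
Proof.
  intros H1 H2 Hz.
  apply is_Cseries_unique with (1 := PS_series _ z (subexp_lin b d c H1 H2) Hz).
  replace (PS b z - c * PS d z)%C with (PS b z + (-c) * PS d z)%C by ring.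
  eapply is_Cseries_ext.
  2: apply is_Cseries_plus; [|apply is_Cseries_scal]; apply PS_series; eassumption.
  intros k; simpl; ring.
Qed.

(** If e_k denotes the remainder on the left, then e_(k+1) = w e_k + (k+1) z^k (w - z)^2, which
    drives the induction. The extra factor r on the left avoids the exponent k - 1, and the constant
    (k+1)^2 is deliberately crude. *)
Lemma Cpow_taylor2 (r : R) (z w : C) (k : nat) :
  Cmod z <= r -> Cmod w <= r -> 0 <= r ->
  Cmod (w ^ S k - z ^ S k - INR (S k) * z ^ k * (w - z)) * r
    <= INR (S k) * INR (S k) * r ^ k * Cmod (w - z) ^ 2.
Proof.
  intros Hz Hw Hr. set (h := Cmod (w - z)).
  assert (Hh : 0 <= h ^ 2) by apply pow2_ge_0.
  induction k as [|k IH].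
  - replace (w ^ 1 - z ^ 1 - INR 1 * z ^ 0 * (w - z))%C with (RtoC 0) by (simpl; ring).
    rewrite Cmod_0. simpl. simpl in Hh. lra.
  - set (n := INR (S k)) in *.
    assert (Hn : 0 <= n) by apply pos_INR.
    replace (w ^ S (S k) - z ^ S (S k) - INR (S (S k)) * z ^ S k * (w - z))%C
      with (w * (w ^ S k - z ^ S k - n * z ^ k * (w - z)) + n * z ^ k * (w - z) ^ 2)%C.
    2: { rewrite (S_INR (S k)); fold n; rewrite RtoC_plus. simpl; ring. }
    rewrite (S_INR (S k)); fold n.
    set (e := (w ^ S k - z ^ S k - n * z ^ k * (w - z))%C) in *.
    assert (A : Cmod (w * e + n * z ^ k * (w - z) ^ 2) <= Cmod w * Cmod e + n * Cmod z ^ k * h ^ 2).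
    { eapply Rle_trans; [apply Cmod_triangle|].
      rewrite !Cmod_mult, !Cmod_pow, Cmod_R, (Rabs_pos_eq n Hn). fold h. lra. }
    assert (B : Cmod z ^ k <= r ^ k) by (apply pow_incr; split; [apply Cmod_ge_0 | trivial]).
    assert (P := Cmod_ge_0 e). assert (Pk : 0 <= r ^ k) by now apply pow_le.
    assert (B1 : Cmod w * Cmod e <= r * Cmod e) by (apply Rmult_le_compat_r; trivial).
    assert (B2 : n * Cmod z ^ k * h ^ 2 <= n * r ^ k * h ^ 2)
      by (apply Rmult_le_compat_r; trivial; now apply Rmult_le_compat_l).
    apply Rle_trans with ((r * Cmod e + n * r ^ k * h ^ 2) * r).
    + apply Rmult_le_compat_r; trivial. lra.
    + assert (C1 : r * (Cmod e * r) <= r * (n * n * r ^ k * h ^ 2)) by now apply Rmult_le_compat_l.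
      assert (0 <= (n + 1) * (r * (r ^ k * h ^ 2))).
      { apply Rmult_le_pos; [lra|]. apply Rmult_le_pos; trivial. now apply Rmult_le_pos. }
      change (r ^ S k) with (r * r ^ k). lra.
Qed.

(** Summing the Taylor bounds of the powers costs the weight (k+1)^2, and multiplying coefficients
    by their index twice preserves [subexp]. Both continuity and differentiability of power series
    are drawn from this estimate. *)
Lemma PS_quad (b : nat -> C) (r : R) :
  subexp b -> 0 < r < 1 -> exists K, 0 <= K /\ forall z w,
    Cmod z <= r -> Cmod w <= r ->
    Cmod (PS b w - PS b z - PS (dcoef b) z * (w - z)) <= K * Cmod (w - z) ^ 2.
Proof.
  intros H Hr.
  set (c := fun k => (INR k * (INR k * b k))%C).
  assert (Hc : subexp c) by (apply subexp_mul_INR, subexp_mul_INR; exact H).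
  set (K0 := Series (fun k => Cmod (c (S k)) * r ^ k)).
  assert (Ex : ex_series (fun k => Cmod (c (S k)) * r ^ k)).
  { apply (subexp_ex_series (fun k => c (S k))); [now apply subexp_shift | lra]. }
  (* The modulus bound for a convergent series already forces this sum to be nonnegative. *)
  assert (K0pos : 0 <= K0).
  { assert (E : forall k, Cmod (c (S k) * r ^ k) <= Cmod (c (S k)) * r ^ k).
    { intros k. rewrite Cmod_mult, <- RtoC_pow, Cmod_R, Rabs_pos_eq; [lra | apply pow_le; lra]. }
    generalize (is_Cseries_Cmod_le _ _ _ E Ex (ex_Cseries_abs _ _ E Ex)).
    intros E'. apply (Rle_trans _ _ _ (Cmod_ge_0 _)) in E'. unfold K0; lra. }
  exists (2 * (K0 / r)). split.
  { apply Rmult_le_pos; [lra | apply Rdiv_le_0_compat; lra]. }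
  intros z w Hz Hw.
  assert (Hz1 : Cmod z < 1) by lra. assert (Hw1 : Cmod w < 1) by lra.
  set (h := Cmod (w - z)).
  (* The constant terms cancel, so the series is indexed from the linear term on. *)
  assert (S1 : is_Cseries
     (fun k => b (S k) * (w ^ S k - z ^ S k - INR (S k) * z ^ k * (w - z)))%C
     (PS b w - PS b z - PS (dcoef b) z * (w - z))%C).
  { rewrite (PS_shift b w H Hw1), (PS_shift b z H Hz1).
    set (bs := fun k => b (S k)).
    replace (b 0%nat + w * PS bs w - (b 0%nat + z * PS bs z) - PS (dcoef b) z * (w - z))%C
      with (w * PS bs w + ((-z) * PS bs z + (-(w - z)) * PS (dcoef b) z))%C by ring.
    assert (Hs : subexp bs) by now apply subexp_shift.
    eapply is_Cseries_ext.
    2: apply is_Cseries_plus; [|apply is_Cseries_plus]; apply is_Cseries_scal; apply PS_series;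
       trivial; now apply subexp_dcoef.
    intros k; unfold bs, dcoef; simpl; ring. }
  set (v := fun k => Cmod (c (S k)) * r ^ k).
  replace (2 * (K0 / r) * h ^ 2) with (2 * Series (fun k => h ^ 2 / r * v k)).
  2: { rewrite Series_scal_l. unfold K0, v. field; lra. }
  eapply is_Cseries_Cmod_le; [| | exact S1].
  - intros k. unfold v, c. rewrite !Cmod_mult, Cmod_R, (Rabs_pos_eq _ (pos_INR _)).
    generalize (Cpow_taylor2 r z w k Hz Hw (Rlt_le _ _ (proj1 Hr))). fold h.
    intros E.
    set (e := Cmod (w ^ S k - z ^ S k - INR (S k) * z ^ k * (w - z))) in *.
    assert (E2 : e <= INR (S k) * INR (S k) * r ^ k * h ^ 2 / r).
    { apply Rmult_le_reg_r with r; [lra|]. eapply Rle_trans; [exact E|]. right; field; lra. }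
    replace (h ^ 2 / r * (INR (S k) * (INR (S k) * Cmod (b (S k))) * r ^ k))
      with (Cmod (b (S k)) * (INR (S k) * INR (S k) * r ^ k * h ^ 2 / r)) by (field; lra).
    apply Rmult_le_compat_l; trivial. apply Cmod_ge_0.
  - apply (ex_series_scal (V := R_NormedModule)). exact Ex.
Qed.

(** * Differentiation along curves and in logarithmic coordinates *)

(** Differentiation along a real parameter: holomorphy will be expressed by the two partial
    derivatives in s and t, each of which is of this kind. *)
Definition cder (g : R -> C) (x : R) (d : C) : Prop :=
  is_derive (fun y => Re (g y)) x (Re d) /\ is_derive (fun y => Im (g y)) x (Im d).

Lemma cder_eq (g : R -> C) (x : R) (d d' : C) : cder g x d -> d = d' -> cder g x d'.
Proof. now intros H <-. Qed.

Lemma cder_ext (g h : R -> C) (x : R) (d : C) :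
  (forall y, g y = h y) -> cder g x d -> cder h x d.
Proof.
  intros E [H1 H2]; split; (eapply is_derive_ext; [|eassumption]);
    intros t; simpl; now rewrite E.
Qed.

Lemma cder_const (c : C) (x : R) : cder (fun _ => c) x 0%C.
Proof. split; apply @is_derive_const. Qed.

Lemma cder_plus (g h : R -> C) (x : R) (d e : C) :
  cder g x d -> cder h x e -> cder (fun y => g y + h y)%C x (d + e)%C.
Proof. intros [H1 H2] [H3 H4]; split; now apply @is_derive_plus. Qed.

(* Naming the coordinates keeps is_derive in the syntactic form that auto_derive recognises. *)
Ltac coords g x d H1 H2 :=
  let u := fresh "u" in let v := fresh "v" in let a := fresh "a" in let b := fresh "b" in
  set (u := fun y : R => Re (g y)); set (v := fun y : R => Im (g y));
  set (a := Re d) in *; set (b := Im d) in *;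
  change (is_derive u x a) in H1; change (is_derive v x b) in H2.

(** The known derivatives settle the differentiability conditions and then replace each [Derive],
    leaving an algebraic identity. *)
Ltac derive_coords :=
  auto_derive; [repeat split; try (eexists; eassumption); simpl |
   repeat match goal with H : is_derive ?f ?x ?l |- _ =>
     apply (is_derive_unique f x l) in H; change (Derive (fun y : R => f y) x = l) in H;
     rewrite H; clear H end].

Lemma cder_mult (g h : R -> C) (x : R) (d e : C) :
  cder g x d -> cder h x e -> cder (fun y => g y * h y)%C x (d * h x + g x * e)%C.
Proof.
  intros [H1 H2] [H3 H4].
  coords g x d H1 H2; coords h x e H3 H4.
  split.
  - change (is_derive (fun y => u y * u0 y - v y * v0 y) x
      (a * u0 x - b * v0 x + (u x * a0 - v x * b0))). derive_coords; ring.
  - change (is_derive (fun y => u y * v0 y + v y * u0 y) x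
      (a * v0 x + b * u0 x + (u x * b0 + v x * a0))). derive_coords; ring.
Qed.

Lemma Csq_pos (w : C) : w <> 0%C -> 0 < fst w * fst w + snd w * snd w.
Proof.
  intros H. destruct w as [x y]; simpl.
  destruct (Req_dec x 0) as [->|Hx]; [|nra].
  destruct (Req_dec y 0) as [->|Hy]; [now destruct H | nra].
Qed.

Lemma cder_inv (g : R -> C) (x : R) (d : C) :
  g x <> 0%C -> cder g x d -> cder (fun y => / g y)%C x (- d * / (g x) * / (g x))%C.
Proof.
  intros Hg [H1 H2]. assert (P := Csq_pos _ Hg).
  change (0 < Re (g x) * Re (g x) + Im (g x) * Im (g x)) in P.
  coords g x d H1 H2. change (0 < u x * u x + v x * v x) in P.
  set (n := u x ^ 2 + v x ^ 2).
  split.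
  - apply (is_derive_ext (fun y => u y / (u y ^ 2 + v y ^ 2))); [reflexivity|].
    replace (Re (- d * / g x * / g x)%C) with
      (((- a) * (u x / n) - (- b) * (- v x / n)) * (u x / n) -
       ((- a) * (- v x / n) + (- b) * (u x / n)) * (- v x / n)) by reflexivity.
    derive_coords; [lra | unfold n; field; lra].
  - apply (is_derive_ext (fun y => - v y / (u y ^ 2 + v y ^ 2))); [reflexivity|].
    replace (Im (- d * / g x * / g x)%C) with
      (((- a) * (u x / n) - (- b) * (- v x / n)) * (- v x / n) +
       ((- a) * (- v x / n) + (- b) * (u x / n)) * (u x / n)) by reflexivity.
    derive_coords; [lra | unfold n; field; lra].
Qed.

Definition cexp (w : C) : C := (exp (Re w) * cos (Im w), exp (Re w) * sin (Im w)).

(** The principal logarithm in the form valid on the right half-plane [0 < Re w], which contains the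
    sector. *)
Definition clog (w : C) : C := (ln (Re w ^ 2 + Im w ^ 2) / 2, atan (Im w / Re w)).

Lemma cder_exp (g : R -> C) (x : R) (d : C) :
  cder g x d -> cder (fun y => cexp (g y)) x (cexp (g x) * d)%C.
Proof.
  intros [H1 H2].
  coords g x d H1 H2. split.
  - apply (is_derive_ext (fun y => exp (u y) * cos (v y))); [reflexivity|].
    replace (Re (cexp (g x) * d)%C) with
      (exp (u x) * cos (v x) * a - exp (u x) * sin (v x) * b) by reflexivity.
    derive_coords; trivial; ring.
  - apply (is_derive_ext (fun y => exp (u y) * sin (v y))); [reflexivity|].
    replace (Im (cexp (g x) * d)%C) with
      (exp (u x) * cos (v x) * b + exp (u x) * sin (v x) * a) by reflexivity.
    derive_coords; trivial; ring.
Qed.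

Lemma cder_log (g : R -> C) (x : R) (d : C) :
  0 < Re (g x) -> cder g x d -> cder (fun y => clog (g y)) x (d * / g x)%C.
Proof.
  intros Hg [H1 H2].
  coords g x d H1 H2. change (0 < u x) in Hg.
  assert (P : 0 < u x ^ 2 + v x ^ 2) by nra.
  set (n := u x ^ 2 + v x ^ 2) in *.
  split.
  - apply (is_derive_ext (fun y => ln (u y ^ 2 + v y ^ 2) / 2)); [reflexivity|].
    replace (Re (d * / g x)%C) with (a * (u x / n) - b * (- v x / n)) by reflexivity.
    derive_coords; [unfold n in P; lra | unfold n; field; unfold n in P; lra].
  - apply (is_derive_ext (fun y => atan (v y / u y))); [reflexivity|].
    replace (Im (d * / g x)%C) with (a * (- v x / n) + b * (u x / n)) by reflexivity.
    derive_coords; [lra | unfold n; field; unfold n in P; repeat split; simpl in *; lra].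
Qed.

(** Both functions vanish at x, so the difference quotients of [r] are dominated by those of [h]. *)
Lemma is_derive_squeeze (r h : R -> R) (x : R) :
  is_derive h x 0 -> h x = 0 -> locally x (fun y => Rabs (r y) <= h y) -> is_derive r x 0.
Proof.
  intros Hd H0 Hl.
  assert (r0 : r x = 0).
  { apply locally_singleton in Hl. rewrite H0 in Hl.
    generalize (Rabs_pos (r x)); intros. apply Rabs_eq_0; lra. }
  apply is_derive_Reals in Hd. apply is_derive_Reals.
  intros eps Heps. destruct (Hd eps Heps) as [dl Hdl].
  destruct Hl as [dl2 Hl2].
  assert (Hm : 0 < Rmin dl dl2) by (apply Rmin_pos; apply cond_pos).
  exists (mkposreal _ Hm). simpl. intros t Ht Htd.
  specialize (Hdl t Ht (Rlt_le_trans _ _ _ Htd (Rmin_l _ _))).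
  assert (B : Rabs (r (x + t)) <= h (x + t)).
  { apply Hl2. unfold ball; simpl; unfold AbsRing_ball, abs, minus, plus, opp; simpl.
    replace (x + t + - x) with t by ring. exact (Rlt_le_trans _ _ _ Htd (Rmin_r _ _)). }
  rewrite r0, H0 in *. rewrite !Rminus_0_r in *.
  eapply Rle_lt_trans; [|exact Hdl].
  unfold Rdiv. rewrite !Rabs_mult. apply Rmult_le_compat_r; [apply Rabs_pos|].
  eapply Rle_trans; [exact B | apply Rle_abs].
Qed.

(* The second-order Taylor remainder of PS along g is dominated by K |g y - g x|^2, whose derivative at x vanishes. *)
Lemma cder_PS (b : nat -> C) (g : R -> C) (x : R) (d : C) :
  subexp b -> Cmod (g x) < 1 -> cder g x d ->
  cder (fun y => PS b (g y)) x (PS (dcoef b) (g x) * d)%C.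
Proof.
  intros Hb Hg Hd.
  set (r := (Cmod (g x) + 1) / 2).
  assert (P := Cmod_ge_0 (g x)).
  assert (Hr : Cmod (g x) < r /\ 0 < r < 1) by (unfold r; lra).
  destruct (PS_quad b r Hb (proj2 Hr)) as [K [HK Q]].
  set (c := PS (dcoef b) (g x)).
  set (rho := fun y => (PS b (g y) - PS b (g x) - c * (g y - g x))%C).
  set (h := fun y => K * ((Re (g y) - Re (g x)) ^ 2 + (Im (g y) - Im (g x)) ^ 2)).
  assert (Hh : is_derive h x 0).
  { destruct Hd as [H1 H2]. clear - H1 H2. unfold h. coords g x d H1 H2.
    change (is_derive (fun y => K * ((u y - u x) ^ 2 + (v y - v x) ^ 2)) x 0).
    derive_coords; trivial; ring. }
  assert (h0 : h x = 0) by (unfold h; ring).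
  (* Continuity of [g] keeps nearby values in the disc of radius r, where the quadratic estimate
     applies. *)
  assert (HL : locally x (fun y => Cmod (rho y) <= h y)).
  { assert (HL : locally x (fun y => Cmod (g y) <= r)).
    { assert (Cg : continuous (fun y => Rabs (Re (g y)-Re (g x)) + Rabs (Im (g y) - Im (g x))) x).
      { destruct Hd as [H1 H2].
        apply (continuous_plus (V := R_NormedModule)); apply (continuous_comp _ Rabs);
          try apply continuous_Rabs; apply (continuous_minus (V := R_NormedModule));
          try apply continuous_const; apply (ex_derive_continuous (V := R_NormedModule));
          eexists; eassumption. }
      assert (He : 0 < r - Cmod (g x)) by lra.
      generalize (proj1 (filterlim_locally _ _) Cg (mkposreal _ He)).
      apply filter_imp. intros y Hy.
      unfold ball in Hy; simpl in Hy; unfold AbsRing_ball, abs, minus, plus, opp in Hy; simpl in Hy.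
      rewrite !Rminus_diag, !Rabs_R0 in Hy.
      assert (E := Cmod_le_abs (g y - g x)).
      change (Re (g y - g x)%C) with (Re (g y) - Re (g x)) in E.
      change (Im (g y - g x)%C) with (Im (g y) - Im (g x)) in E.
      apply Rabs_def2 in Hy.
      replace (g y) with (g y - g x + g x)%C by ring.
      eapply Rle_trans; [apply Cmod_triangle|]. lra. }
    generalize HL. apply filter_imp. intros y Hy.
    generalize (Q (g x) (g y) (Rlt_le _ _ (proj1 Hr)) Hy).
    fold c. rewrite Cmod2_alt. intros E. exact E. }
  assert (Hrho : cder rho x 0%C).
  { split; apply (is_derive_squeeze _ h); trivial; generalize HL; apply filter_imp;
      intros y Hy; (eapply Rle_trans; [|exact Hy]); [apply re_le_Cmod | apply im_le_Cmod]. }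
  apply cder_ext with (fun y => rho y + (PS b (g x) + c * (g y + - g x)))%C.
  { intros y; unfold rho; ring. }
  eapply cder_eq.
  - apply cder_plus; [exact Hrho|].
    apply cder_plus; [apply cder_const|].
    apply (cder_mult (fun _ => c)); [apply cder_const|].
    apply cder_plus; [exact Hd | apply cder_const].
  - ring.
Qed.

(** * Joint continuity in two real variables *)

Definition ccont2 (W : R -> R -> C) (s t : R) : Prop :=
  continuity_2d_pt (fun u v => Re (W u v)) s t /\ continuity_2d_pt (fun u v => Im (W u v)) s t.

Lemma ccont2_const (c : C) (s t : R) : ccont2 (fun _ _ => c) s t.
Proof. split; apply continuity_2d_pt_const. Qed.

Lemma ccont2_plus (W V : R -> R -> C) (s t : R) :
  ccont2 W s t -> ccont2 V s t -> ccont2 (fun u v => W u v + V u v)%C s t.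
Proof. intros [H1 H2] [H3 H4]; split; now apply continuity_2d_pt_plus. Qed.

Lemma ccont2_mult (W V : R -> R -> C) (s t : R) :
  ccont2 W s t -> ccont2 V s t -> ccont2 (fun u v => W u v * V u v)%C s t.
Proof.
  intros [H1 H2] [H3 H4]; split.
  - now apply continuity_2d_pt_minus; apply continuity_2d_pt_mult.
  - now apply continuity_2d_pt_plus; apply continuity_2d_pt_mult.
Qed.

Lemma ccont2_inv (W : R -> R -> C) (s t : R) :
  W s t <> 0%C -> ccont2 W s t -> ccont2 (fun u v => / W u v)%C s t.
Proof.
  intros Hw [H1 H2]. assert (P := Csq_pos _ Hw).
  assert (N : continuity_2d_pt (fun u v => / (fst (W u v) ^ 2 + snd (W u v) ^ 2)) s t).
  { apply continuity_2d_pt_inv; [|simpl; lra].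
    apply continuity_2d_pt_plus; simpl; repeat apply continuity_2d_pt_mult; trivial;
      apply continuity_2d_pt_const. }
  split; unfold Cinv, Rdiv; simpl; apply continuity_2d_pt_mult; trivial.
  now apply continuity_2d_pt_opp.
Qed.

Lemma ccont2_exp (W : R -> R -> C) (s t : R) :
  ccont2 W s t -> ccont2 (fun u v => cexp (W u v)) s t.
Proof.
  intros [H1 H2]; split; unfold cexp, Re at 1, Im at 1; simpl;
    apply continuity_2d_pt_mult; apply continuity_1d_2d_pt_comp; trivial;
    apply derivable_continuous_pt; reg.
Qed.

Lemma ccont2_log (W : R -> R -> C) (s t : R) :
  0 < Re (W s t) -> ccont2 W s t -> ccont2 (fun u v => clog (W u v)) s t.
Proof.
  intros Hw [H1 H2]; split; unfold clog, Re at 1, Im at 1; simpl; unfold Rdiv.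
  - apply continuity_2d_pt_mult; [|apply continuity_2d_pt_const].
    apply continuity_1d_2d_pt_comp.
    + apply derivable_continuous_pt. exists (/ (Re (W s t) * (Re (W s t) * 1) + Im (W s t) * (Im (W s t) * 1))).
      apply derivable_pt_lim_ln. nra.
    + apply continuity_2d_pt_plus; repeat apply continuity_2d_pt_mult; trivial;
        apply continuity_2d_pt_const.
  - apply continuity_1d_2d_pt_comp.
    + apply derivable_continuous_pt, derivable_pt_atan.
    + apply continuity_2d_pt_mult; trivial. apply continuity_2d_pt_inv; trivial. lra.
Qed.

Definition ccont (F : C -> C) (w : C) : Prop :=
  forall eps, 0 < eps -> exists dl, 0 < dl /\
    forall v, Cmod (v - w) < dl -> Cmod (F v - F w) < eps.

Lemma ccont_of_ccont2 (F : C -> C) (w : C) :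
  ccont2 (fun u v => F (u, v)) (Re w) (Im w) -> ccont F w.
Proof.
  intros [H1 H2] eps He.
  assert (He2 : 0 < eps / 2) by lra.
  destruct (locally_2d_and _ _ _ _ (H1 (mkposreal _ He2)) (H2 (mkposreal _ He2))) as [dl Hdl].
  exists dl. split; [apply cond_pos|]. intros v Hv.
  destruct (Hdl (Re v) (Im v)) as [B1 B2].
  { eapply Rle_lt_trans; [apply (re_le_Cmod (v - w)) | exact Hv]. }
  { eapply Rle_lt_trans; [apply (im_le_Cmod (v - w)) | exact Hv]. }
  destruct v as [v1 v2], w as [w1 w2].
  change (Rabs (Re (F (v1, v2)) - Re (F (w1, w2))) < eps / 2) in B1.
  change (Rabs (Im (F (v1, v2)) - Im (F (w1, w2))) < eps / 2) in B2.
  eapply Rle_lt_trans; [apply Cmod_le_abs|].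
  change (Rabs (Re (F (v1, v2)) - Re (F (w1, w2))) + Rabs (Im (F (v1, v2)) - Im (F (w1, w2))) < eps).
  lra.
Qed.

Lemma ccont2_comp (F : C -> C) (W : R -> R -> C) (s t : R) :
  ccont F (W s t) -> ccont2 W s t -> ccont2 (fun u v => F (W u v)) s t.
Proof.
  intros HF [H1 H2].
  assert (A : forall eps, 0 < eps -> locally_2d
     (fun u v => Cmod (F (W u v) - F (W s t)) < eps) s t).
  { intros eps He. destruct (HF eps He) as [dl [Hdl Q]].
    assert (Hd2 : 0 < dl / 2) by lra.
    generalize (locally_2d_and _ _ _ _ (H1 (mkposreal _ Hd2)) (H2 (mkposreal _ Hd2))).
    apply locally_2d_impl, locally_2d_forall. simpl. intros u v [B1 B2]. apply Q.
    eapply Rle_lt_trans; [apply Cmod_le_abs|].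
    change (Rabs (Re (W u v) - Re (W s t)) + Rabs (Im (W u v) - Im (W s t)) < dl). lra. }
  split; intros eps; generalize (A eps (cond_pos eps)); apply locally_2d_impl, locally_2d_forall;
    intros u v B; (eapply Rle_lt_trans; [|exact B]).
  - apply (re_le_Cmod (F (W u v) - F (W s t))).
  - apply (im_le_Cmod (F (W u v) - F (W s t))).
Qed.

Lemma ccont_PS (b : nat -> C) (z : C) : subexp b -> Cmod z < 1 -> ccont (PS b) z.
Proof.
  intros Hb Hz eps He.
  set (r := (Cmod z + 1) / 2).
  assert (P := Cmod_ge_0 z).
  assert (Hr : Cmod z < r /\ 0 < r < 1) by (unfold r; lra).
  destruct (PS_quad b r Hb (proj2 Hr)) as [K [HK Q]].
  set (c := PS (dcoef b) z). assert (Pc := Cmod_ge_0 c).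
  (* Since r - |z| <= 1, the increment h is at most 1, hence K h^2 + |c| h <= h L; the summand 1
     makes [L] positive. *)
  set (L := K + Cmod c + 1).
  assert (HL : 0 < L) by (unfold L; lra).
  exists (Rmin (eps / L) (r - Cmod z)). split.
  { apply Rmin_pos; [apply Rdiv_lt_0_compat; lra | lra]. }
  intros w Hw.
  assert (M1 := Rmin_l (eps / L) (r - Cmod z)).
  assert (M2 := Rmin_r (eps / L) (r - Cmod z)).
  assert (Hwr : Cmod w <= r).
  { replace w with (w - z + z)%C by ring. eapply Rle_trans; [apply Cmod_triangle|]. lra. }
  generalize (Q z w (Rlt_le _ _ (proj1 Hr)) Hwr). fold c. intros E.
  set (h := Cmod (w - z)) in *.
  assert (Ph : 0 <= h) by apply Cmod_ge_0.
  assert (h <= 1) by lra.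
  assert (E2 : Cmod (PS b w - PS b z) <= K * h ^ 2 + Cmod c * h).
  { replace (PS b w - PS b z)%C with ((PS b w - PS b z - c * (w - z)) + c * (w - z))%C by ring.
    eapply Rle_trans; [apply Cmod_triangle|]. rewrite (Cmod_mult c). fold h. lra. }
  assert (K * h ^ 2 <= K * h) by (apply Rmult_le_compat_l; simpl; nra).
  assert (E3 : h * L < eps).
  { replace eps with (eps / L * L) by (field; lra). apply Rmult_lt_compat_r; lra. }
  replace (h * L) with (K * h + Cmod c * h + h) in E3 by (unfold L; ring). lra.
Qed.

(** [hol W D]: in the logarithmic coordinate zeta = s + i t, the function W is holomorphic on Re zeta < 0 with continuous derivative D. *)
Definition hol (W D : R -> R -> C) : Prop :=
  forall s t, s < 0 ->
    cder (fun x => W x t) s (D s t) /\ cder (fun y => W s y) t (Ci * D s t)%C /\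
    ccont2 W s t /\ ccont2 D s t.

(** Hiding the derivative lets the closure lemmas compose without carrying its formula along. *)
Definition ex_hol (W : R -> R -> C) : Prop := exists D, hol W D.

Lemma ex_hol_ext (W V : R -> R -> C) :
  (forall s t, W s t = V s t) -> ex_hol W -> ex_hol V.
Proof.
  intros E [D H]. exists D. intros s t Hs. destruct (H s t Hs) as [H1 [H2 [[H3 H4] H5]]].
  split; [apply (cder_ext (fun x => W x t)); [intros; apply E | exact H1]|].
  split; [apply (cder_ext (fun y => W s y)); [intros; apply E | exact H2]|].
  split; [split|trivial]; [refine (continuity_2d_pt_ext _ _ _ _ _ H3) |
    refine (continuity_2d_pt_ext _ _ _ _ _ H4)]; intros; simpl; now rewrite E.
Qed.

Lemma ex_hol_const (c : C) : ex_hol (fun _ _ => c).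
Proof.
  exists (fun _ _ => 0%C). intros s t _.
  split; [apply cder_const|].
  split; [eapply cder_eq; [apply cder_const | ring]|].
  split; apply ccont2_const.
Qed.

(** This is the map a zeta + i b. Under [cexp], a = 1 yields the rotations of z, and a = - n, b = 0
    yields the factor z^(-n). *)
Lemma ex_hol_id (a b : R) : ex_hol (fun s t => (a * s, a * t + b)).
Proof.
  exists (fun _ _ => RtoC a). intros s t _.
  split; [split|split; [split|split; [split|apply ccont2_const]]].
  - change (is_derive (fun x => a * x) s a). auto_derive; trivial; ring.
  - change (is_derive (fun x => a * t + b) s 0). auto_derive; trivial; ring.
  - change (is_derive (fun x => a * s) t (0 * a - 1 * 0)). auto_derive; trivial; ring.
  - change (is_derive (fun x => a * x + b) t (0 * 0 + 1 * a)). auto_derive; trivial; ring.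
  - apply continuity_2d_pt_mult; [apply continuity_2d_pt_const | apply continuity_2d_pt_id1].
  - apply continuity_2d_pt_plus; [apply continuity_2d_pt_mult|];
      [apply continuity_2d_pt_const | apply continuity_2d_pt_id2 | apply continuity_2d_pt_const].
Qed.

Lemma ex_hol_plus (W V : R -> R -> C) :
  ex_hol W -> ex_hol V -> ex_hol (fun s t => W s t + V s t)%C.
Proof.
  intros [D H] [E I]. exists (fun s t => D s t + E s t)%C. intros s t Hs.
  destruct (H s t Hs) as [H1 [H2 [H3 H4]]], (I s t Hs) as [I1 [I2 [I3 I4]]].
  split; [now apply cder_plus|]. split; [|split; now apply ccont2_plus].
  eapply cder_eq; [now apply cder_plus; eassumption | ring].
Qed.

Lemma ex_hol_mult (W V : R -> R -> C) :
  ex_hol W -> ex_hol V -> ex_hol (fun s t => W s t * V s t)%C.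
Proof.
  intros [D H] [E I]. exists (fun s t => D s t * V s t + W s t * E s t)%C. intros s t Hs.
  destruct (H s t Hs) as [H1 [H2 [H3 H4]]], (I s t Hs) as [I1 [I2 [I3 I4]]].
  split; [now apply (cder_mult (fun x => W x t) (fun x => V x t))|].
  split; [|split; [|apply ccont2_plus]; now apply ccont2_mult].
  eapply cder_eq; [now apply (cder_mult (fun x => W s x) (fun x => V s x)); eassumption | ring].
Qed.

Lemma ex_hol_inv (W : R -> R -> C) :
  (forall s t, s < 0 -> W s t <> 0%C) -> ex_hol W -> ex_hol (fun s t => / W s t)%C.
Proof.
  intros H0 [D H]. exists (fun s t => (- (1)) * (D s t * (/ W s t * / W s t)))%C. intros s t Hs.
  destruct (H s t Hs) as [H1 [H2 [H3 H4]]]. specialize (H0 s t Hs).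
  split; [eapply cder_eq; [apply (cder_inv (fun x => W x t)); eassumption | ring]|].
  split; [eapply cder_eq; [apply (cder_inv (fun x => W s x)); eassumption | ring]|].
  split; [|apply ccont2_mult; [apply ccont2_const | repeat apply ccont2_mult; trivial]];
    now apply ccont2_inv.
Qed.

Lemma ex_hol_exp (W : R -> R -> C) : ex_hol W -> ex_hol (fun s t => cexp (W s t)).
Proof.
  intros [D H]. exists (fun s t => cexp (W s t) * D s t)%C. intros s t Hs.
  destruct (H s t Hs) as [H1 [H2 [H3 H4]]].
  split; [apply (cder_exp (fun x => W x t)); eassumption |].
  split; [eapply cder_eq; [apply (cder_exp (fun x => W s x)); eassumption | ring]|].
  split; [|apply ccont2_mult; trivial]; now apply ccont2_exp.
Qed.

Lemma ex_hol_log (W : R -> R -> C) :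
  (forall s t, s < 0 -> 0 < Re (W s t)) -> ex_hol W -> ex_hol (fun s t => clog (W s t)).
Proof.
  intros H0 [D H]. exists (fun s t => D s t * / W s t)%C. intros s t Hs.
  destruct (H s t Hs) as [H1 [H2 [H3 H4]]]. specialize (H0 s t Hs).
  split; [apply (cder_log (fun x => W x t)); eassumption |].
  split; [eapply cder_eq; [apply (cder_log (fun x => W s x)); eassumption | ring]|].
  split; [now apply ccont2_log | apply ccont2_mult; trivial]. apply ccont2_inv; trivial.
  intros E. rewrite E in H0. simpl in H0. lra.
Qed.

Lemma ex_hol_PS (b : nat -> C) (W : R -> R -> C) :
  subexp b -> (forall s t, s < 0 -> Cmod (W s t) < 1) -> ex_hol W ->
  ex_hol (fun s t => PS b (W s t)).
Proof.
  intros Hb H0 [D H]. exists (fun s t => PS (dcoef b) (W s t) * D s t)%C. intros s t Hs.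
  destruct (H s t Hs) as [H1 [H2 [H3 H4]]]. specialize (H0 s t Hs).
  split; [apply (cder_PS b (fun x => W x t)); eassumption |].
  split; [eapply cder_eq; [apply (cder_PS b (fun x => W s x)); eassumption | ring]|].
  split; [|apply ccont2_mult; trivial]; apply ccont2_comp; trivial; apply ccont_PS; trivial. now apply subexp_dcoef.
Qed.

(** * The mean value property *)

Lemma continuity_2d_pt_section (f : R -> R -> R) (s t : R) :
  continuity_2d_pt f s t -> continuous (fun y => f s y) t.
Proof.
  intros H. apply continuity_2d_pt_filterlim in H.
  apply (continuous_comp_2 (fun _ : R => s) (fun y : R => y) f); try apply continuous_const;
    try apply continuous_id. exact H.
Qed.

Lemma hol_ex_RInt (W D : R -> R -> C) (s : R) :
  hol W D -> s < 0 -> ex_RInt (fun t => Re (W s t)) 0 (2 * PI).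
Proof.
  intros H Hs. apply (ex_RInt_continuous (V := R_CompleteNormedModule)). intros t _.
  destruct (H s t Hs) as [_ [_ [[H3 _] _]]].
  exact (continuity_2d_pt_section (fun u v => Re (W u v)) s t H3).
Qed.

(* Differentiating under the integral sign, d/ds (Re W) = d/dt (Im W) by Cauchy-Riemann, which integrates to 0 over a period. *)
Lemma mean_derive_0 (W D : R -> R -> C) (s : R) :
  hol W D -> (forall s, s < 0 -> W s (2 * PI) = W s 0) -> s < 0 ->
  is_derive (fun x => RInt (fun t => Re (W x t)) 0 (2 * PI)) s 0.
Proof.
  intros H Hp Hs.
  assert (N : locally s (fun x => x < 0)) by now apply open_lt.
  assert (HD : forall x t, x < 0 -> Derive (fun z => Re (W z t)) x = Re (D x t)).
  { intros x t Hx. apply is_derive_unique, (H x t Hx). }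
  assert (Z : RInt (fun t => Derive (fun u => Re (W u t)) s) 0 (2 * PI) = 0).
  { rewrite (RInt_ext _ (fun t => Re (D s t))).
    2: { intros t _. now apply HD. }
    apply is_RInt_unique.
    assert (E0 : minus (Im (W s (2 * PI))) (Im (W s 0)) = 0).
    { rewrite Hp; trivial. unfold minus, plus, opp; simpl. ring. }
    rewrite <- E0 at 2.
    apply (is_RInt_derive (V := R_CompleteNormedModule) (fun t => Im (W s t))); intros t _.
    - destruct (H s t Hs) as [_ [[_ H2] _]].
      replace (Re (D s t)) with (Im (Ci * D s t)%C); [exact H2|].
      unfold Im, Re; simpl; ring.
    - destruct (H s t Hs) as [_ [_ [_ [H4 _]]]].
      exact (continuity_2d_pt_section (fun u v => Re (D u v)) s t H4). }
  generalize (is_derive_RInt_param (fun u t => Re (W u t)) 0 (2 * PI) s). rewrite Z.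
  intros K; apply K.
  - generalize N; apply filter_imp. intros x Hx t _.
    eexists. apply (H x t Hx).
  - intros t _. destruct (H s t Hs) as [_ [_ [_ [H4 _]]]].
    eapply continuity_2d_pt_ext_loc; [|exact H4].
    (* The ball of radius - s about s stays in the negative half-line, where [Derive] agrees with
       the real part of [D]. *)
    assert (Ho : 0 < - s) by lra.
    exists (mkposreal _ Ho). simpl. intros u v Hu _. symmetry. apply HD.
    apply Rabs_def2 in Hu. lra.
  - generalize N; apply filter_imp. intros x Hx. now apply hol_ex_RInt with D.
Qed.

Lemma mean_const (W D : R -> R -> C) (a b : R) :
  hol W D -> (forall s, s < 0 -> W s (2 * PI) = W s 0) -> a < b < 0 ->
  RInt (fun t => Re (W a t)) 0 (2 * PI) = RInt (fun t => Re (W b t)) 0 (2 * PI).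
Proof.
  intros H Hp Hab.
  apply (eq_is_derive (V := R_NormedModule) (fun x => RInt (fun t => Re (W x t)) 0 (2 * PI))); [|lra].
  intros s Hs. apply mean_derive_0 with D; trivial. lra.
Qed.

(** As z = exp zeta, letting s tend to minus infinity uniformly in t means letting z tend to the
    origin. *)
Definition ulim (W : R -> R -> C) (L : C) : Prop :=
  forall eps, 0 < eps -> exists s0, s0 < 0 /\ forall s t, s < s0 -> Cmod (W s t - L) < eps.

Lemma ulim_const (c : C) : ulim (fun _ _ => c) c.
Proof.
  intros eps He. exists (-1). split; [lra|]. intros s t _.
  replace (c - c)%C with (RtoC 0) by ring. now rewrite Cmod_0.
Qed.

Lemma ulim_ext (W V : R -> R -> C) (L : C) :
  (forall s t, s < 0 -> W s t = V s t) -> ulim W L -> ulim V L.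
Proof.
  intros E H eps He. destruct (H eps He) as [s0 [Hs0 Q]].
  exists s0. split; trivial. intros s t Hs. rewrite <- E; [now apply Q | lra].
Qed.

Lemma ulim_comp (F : C -> C) (W : R -> R -> C) (L : C) :
  ccont F L -> ulim W L -> ulim (fun s t => F (W s t)) (F L).
Proof.
  intros HF HW eps He. destruct (HF eps He) as [dl [Hdl Q]].
  destruct (HW dl Hdl) as [s0 [Hs0 Q']].
  exists s0. split; trivial. intros s t Hs. apply Q, Q', Hs.
Qed.

Lemma ulim_plus (W V : R -> R -> C) (L M : C) :
  ulim W L -> ulim V M -> ulim (fun s t => W s t + V s t)%C (L + M)%C.
Proof.
  intros HW HV eps He. destruct (HW (eps / 2)) as [s0 [Hs0 Q]]; [lra|].
  destruct (HV (eps / 2)) as [s1 [Hs1 Q']]; [lra|].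
  exists (Rmin s0 s1). split; [generalize (Rmin_l s0 s1); lra|]. intros s t Hs.
  replace (W s t + V s t - (L + M))%C with ((W s t - L) + (V s t - M))%C by ring.
  eapply Rle_lt_trans; [apply Cmod_triangle|].
  assert (H1 := Q s t (Rlt_le_trans _ _ _ Hs (Rmin_l _ _))).
  assert (H2 := Q' s t (Rlt_le_trans _ _ _ Hs (Rmin_r _ _))). lra.
Qed.

Lemma ulim_mult (W V : R -> R -> C) (L M : C) :
  ulim W L -> ulim V M -> ulim (fun s t => W s t * V s t)%C (L * M)%C.
Proof.
  intros HW HV eps He.
  assert (PL := Cmod_ge_0 L). assert (PM := Cmod_ge_0 M).
  set (k := Cmod L + Cmod M + 1). assert (Hk : 0 < k) by (unfold k; lra).
  set (d := Rmin 1 (eps / k)).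
  assert (Hd : 0 < d) by (apply Rmin_pos; [lra | now apply Rdiv_lt_0_compat]).
  destruct (HW d Hd) as [s0 [Hs0 Q]]. destruct (HV d Hd) as [s1 [Hs1 Q']].
  exists (Rmin s0 s1). split; [generalize (Rmin_l s0 s1); lra|]. intros s t Hs.
  replace (W s t * V s t - L * M)%C with
    ((W s t - L) * (V s t - M) + (L * (V s t - M) + M * (W s t - L)))%C by ring.
  eapply Rle_lt_trans; [apply Cmod_triangle|].
  eapply Rle_lt_trans; [apply Rplus_le_compat_l, Cmod_triangle|]. rewrite !Cmod_mult.
  assert (H1 := Q s t (Rlt_le_trans _ _ _ Hs (Rmin_l _ _))).
  assert (H2 := Q' s t (Rlt_le_trans _ _ _ Hs (Rmin_r _ _))).
  assert (P1 := Cmod_ge_0 (W s t - L)). assert (P2 := Cmod_ge_0 (V s t - M)).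
  set (x := Cmod (W s t - L)) in *. set (y := Cmod (V s t - M)) in *.
  assert (Hd1 : d <= 1) by apply Rmin_l.
  assert (Hd2 : d * k <= eps).
  { apply Rle_trans with (eps / k * k); [|right; field; lra].
    apply Rmult_le_compat_r; [lra | apply Rmin_r]. }
  assert (x * y <= x * 1) by (apply Rmult_le_compat_l; lra).
  assert (Cmod L * y <= Cmod L * d) by (apply Rmult_le_compat_l; lra).
  assert (Cmod M * x <= Cmod M * d) by (apply Rmult_le_compat_l; lra).
  unfold k in Hd2. lra.
Qed.

(** The mean over the circle at s equals the mean over a circle far to the left, where the integrand
    is close to L. Hence Re L <= exp (- n s) for every s < 0, and s is then sent to 0. *)
Lemma ulim_Re_bound (W : R -> R -> C) (L : C) (n : R) :
  ex_hol W -> (forall s, s < 0 -> W s (2 * PI) = W s 0) -> ulim W L ->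
  (forall s t, s < 0 -> Re (W s t) <= exp (- (n * s))) -> Re L <= 1.
Proof.
  intros [D H] Hp HL Hb.
  assert (PI0 := PI_RGT_0).
  assert (A : forall s, s < 0 -> Re L <= exp (- (n * s))).
  { intros s Hs. apply Rnot_lt_le. intros Hlt.
    set (e := Re L - exp (- (n * s))). assert (He : 0 < e) by (unfold e; lra).
    destruct (HL (e / 2)) as [s0 [Hs0 Q]]; [lra|].
    (* A circle small enough for the limit estimate and strictly inside the circle at s. *)
    set (s' := Rmin s0 s - 1).
    assert (Hs' : s' < s0 /\ s' < s).
    { generalize (Rmin_l s0 s) (Rmin_r s0 s). unfold s'. lra. }
    assert (E := mean_const W D s' s H Hp (conj (proj2 Hs') Hs)).
    assert (U : RInt (fun t => Re (W s t)) 0 (2 * PI) <= RInt (fun _ => exp (- (n * s))) 0 (2 * PI)).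
    { apply RInt_le; [lra | now apply hol_ex_RInt with D | apply ex_RInt_const |].
      intros t _. now apply Hb. }
    assert (V : RInt (fun _ => Re L - e / 2) 0 (2 * PI) <= RInt (fun t => Re (W s' t)) 0 (2 * PI)).
    { apply RInt_le; [lra | apply ex_RInt_const | apply hol_ex_RInt with D; trivial; lra |].
      intros t _. assert (B := Q s' t (proj1 Hs')).
      assert (B' := re_le_Cmod (W s' t - L)).
      change (Re (W s' t - L)%C) with (Re (W s' t) - Re L) in B'.
      generalize (Rle_abs (- (Re (W s' t) - Re L))). rewrite Rabs_Ropp. lra. }
    rewrite !RInt_const in *. unfold scal in *; simpl in *; unfold mult in *; simpl in *.
    rewrite E in V.
    assert (Z : (2 * PI - 0) * (Re L - e / 2) <= (2 * PI - 0) * exp (- (n * s))) by lra.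
    apply Rmult_le_reg_l in Z; [unfold e in Z; lra | lra]. }
  apply Rnot_lt_le. intros Hlt.
  (* The bound tends to 1 as s rises to 0; the point s = - dl / 2 already contradicts Re L > 1. *)
  assert (Cn : continuity_pt (fun s => exp (- (n * s))) 0).
  { apply derivable_continuous_pt. reg. }
  destruct (Cn (Re L - 1)) as [dl [Hdl Q]]; [lra|].
  assert (HA := A (- (dl / 2))).
  assert (HQ : Rabs (exp (- (n * - (dl / 2))) - exp (- (n * 0))) < Re L - 1).
  { apply (Q (- (dl / 2))). split; [split; [exact I | lra]|].
    simpl. unfold Rdist. replace (- (dl / 2) - 0) with (- (dl / 2)) by ring.
    rewrite Rabs_Ropp, Rabs_pos_eq; lra. }
  rewrite Rmult_0_r, Ropp_0, exp_0 in HQ. apply Rabs_def2 in HQ. lra.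
Qed.

(** Multiplying by the unimodular constant conj L / |L| turns |L| into a real part and leaves the
    bound on |W| unchanged. *)
Lemma ulim_Cmod_bound (W : R -> R -> C) (L : C) (n : R) :
  ex_hol W -> (forall s, s < 0 -> W s (2 * PI) = W s 0) -> ulim W L ->
  (forall s t, s < 0 -> Cmod (W s t) <= exp (- (n * s))) -> Cmod L <= 1.
Proof.
  intros H Hp HL Hb.
  destruct (Req_dec (Cmod L) 0) as [E|E]; [lra|].
  assert (P := Cmod_ge_0 L).
  set (k := (Cconj L * / Cmod L)%C).
  assert (Hk0 : RtoC (Cmod L) <> 0%C) by (intros Z; apply E; now apply RtoC_inj).
  assert (Hk : Cmod k = 1).
  { unfold k. rewrite Cmod_mult, Cmod_conj, Cmod_inv, Cmod_R, Rabs_pos_eq; trivial. field; lra. }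
  assert (Hkl : Re (k * L)%C = Cmod L).
  { unfold k. replace (Cconj L * / Cmod L * L)%C with (L * Cconj L * / Cmod L)%C by ring.
    rewrite <- Cmod2_conj. replace ((Cmod L ^ 2)%R * / Cmod L)%C with (RtoC (Cmod L)); [reflexivity|].
    rewrite RtoC_pow. field. trivial. }
  rewrite <- Hkl.
  apply (ulim_Re_bound (fun s t => k * W s t)%C _ n).
  - apply ex_hol_mult; trivial. apply ex_hol_const.
  - intros s Hs. now rewrite Hp.
  - apply ulim_mult; trivial. apply ulim_const.
  - intros s t Hs. eapply Rle_trans; [|now apply Hb with (t := t)].
    eapply Rle_trans; [apply Rle_abs|]. eapply Rle_trans; [apply re_le_Cmod|].
    rewrite Cmod_mult, Hk. lra.
Qed.

(** * Principal powers and their difference quotient at 1 *)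

Lemma ccont_inv (w : C) : w <> 0%C -> ccont Cinv w.
Proof.
  intros H. apply ccont_of_ccont2.
  apply (ccont2_inv (fun u v => (u, v))).
  - now destruct w.
  - split; [apply continuity_2d_pt_id1 | apply continuity_2d_pt_id2].
Qed.

Definition cpower (beta : R) (w : C) : C := cexp (beta * clog w).

Lemma cpower_1 (beta : R) : cpower beta 1%C = 1%C.
Proof.
  unfold cpower. replace (clog 1) with (RtoC 0).
  - rewrite Cmult_0_r. unfold cexp; simpl. rewrite exp_0, cos_0, sin_0.
    apply injective_projections; simpl; ring.
  - unfold clog; simpl. replace (1 * (1 * 1) + 0 * (0 * 1)) with 1 by ring.
    rewrite ln_1. unfold Rdiv. rewrite !Rmult_0_l, atan_0. reflexivity.
Qed.

Lemma cder_cpower (beta : R) (g : R -> C) (x : R) (d : C) :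
  0 < Re (g x) -> cder g x d ->
  cder (fun y => cpower beta (g y)) x (cpower beta (g x) * (beta * / g x) * d)%C.
Proof.
  intros Hg Hd. unfold cpower. eapply cder_eq.
  - apply (cder_exp (fun y => beta * clog (g y))%C).
    apply (cder_mult (fun _ => RtoC beta)); [apply cder_const | apply (cder_log g); eassumption].
  - ring.
Qed.

Lemma ccont_cpower (beta : R) (w : C) : 0 < Re w -> ccont (cpower beta) w.
Proof.
  intros H. apply ccont_of_ccont2. unfold cpower.
  apply (ccont2_exp (fun u v => beta * clog (u, v))%C), ccont2_mult; [apply ccont2_const|].
  apply (ccont2_log (fun u v => (u, v))); [exact H|].
  split; [apply continuity_2d_pt_id1 | apply continuity_2d_pt_id2].
Qed.

Lemma ccont_mult (F G : C -> C) (w : C) :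
  ccont F w -> ccont G w -> ccont (fun v => F v * G v)%C w.
Proof.
  intros HF HG. apply ccont_of_ccont2.
  assert (I : ccont2 (fun u v => (u, v)) (Re w) (Im w)).
  { split; [apply continuity_2d_pt_id1 | apply continuity_2d_pt_id2]. }
  apply ccont2_mult; apply (ccont2_comp _ (fun u v => (u, v))); trivial; now destruct w.
Qed.

(** The difference quotient of w^beta at 1, filled in by the derivative. It allows (Q^beta - 1) /
    z^n to be split as a continuous factor times (Q - 1) / z^n. *)
Definition pslope (beta : R) (w : C) : C :=
  if Ceq_dec w 1 then RtoC beta else ((cpower beta w - 1) / (w - 1))%C.

Lemma pslope_eq (beta : R) (w : C) : (cpower beta w - 1 = pslope beta w * (w - 1))%C.
Proof.
  unfold pslope. destruct (Ceq_dec w 1) as [->|H].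
  - rewrite cpower_1. ring.
  - field. intros E. apply H. replace w with (w - 1 + 1)%C by ring. rewrite E. ring.
Qed.

Lemma is_derive_increment_lt (g dg : R -> R) (e : R) :
  (forall x, 0 <= x <= 1 -> is_derive g x (dg x)) ->
  (forall x, 0 <= x <= 1 -> Rabs (dg x) < e) -> Rabs (g 1 - g 0) < e.
Proof.
  intros H He.
  destruct (MVT_gen g 0 1 dg) as [c [Hc E]]; rewrite ?Rmin_left, ?Rmax_right in * by lra.
  - intros x Hx. apply H. lra.
  - intros x Hx. apply derivable_continuous_pt. exists (dg x). apply is_derive_Reals, H. lra.
  - rewrite E, Rminus_0_r, Rmult_1_r. now apply He.
Qed.

(* Mean value inequality along the segment from 1 to v. *)
Lemma ccont_pslope (beta : R) : ccont (pslope beta) 1%C.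
Proof.
  intros eps He.
  set (F' := fun w => (cpower beta w * (beta * / w))%C).
  assert (HF : ccont F' 1%C).
  { apply ccont_mult; [apply ccont_cpower; simpl; lra|].
    apply (ccont_mult (fun _ => RtoC beta)).
    - intros e Hpe. exists 1. split; [lra|]. intros v _.
      replace (beta - beta)%C with (RtoC 0) by ring. now rewrite Cmod_0.
    - apply ccont_inv. intros E. apply RtoC_inj in E. lra. }
  assert (F1 : F' 1%C = RtoC beta).
  { unfold F'. rewrite cpower_1. field. }
  destruct (HF (eps / 2)) as [dl [Hdl Q]]; [lra|]. rewrite F1 in Q.
  (* The cap 1 / 2 keeps the segment from 1 to v in the right half-plane. *)
  assert (M1 := Rmin_l dl (1 / 2)). assert (M2 := Rmin_r dl (1 / 2)).
  exists (Rmin dl (1 / 2)). split; [apply Rmin_pos; lra|]. intros v Hv.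
  unfold pslope at 2. destruct (Ceq_dec 1 1) as [_|N]; [|now destruct N].
  unfold pslope. destruct (Ceq_dec v 1) as [E|N].
  { replace (beta - beta)%C with (RtoC 0) by ring. now rewrite Cmod_0. }
  set (h := (v - 1)%C) in *.
  assert (h0 : h <> 0%C).
  { intros E. apply N. replace v with (h + 1)%C by (unfold h; ring). rewrite E. ring. }
  set (w := fun tau : R => (1 + tau * h)%C).
  assert (Hw : forall tau, 0 <= tau <= 1 -> Cmod (w tau - 1) < Rmin dl (1 / 2)).
  { intros tau Ht. unfold w. replace (1 + tau * h - 1)%C with (tau * h)%C by ring.
    rewrite Cmod_mult, Cmod_R, Rabs_pos_eq; [|lra].
    assert (Pm := Cmod_ge_0 h).
    assert (tau * Cmod h <= 1 * Cmod h) by (apply Rmult_le_compat_r; lra). lra. }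
  (* Chosen so that g 1 - g 0 is the slope minus [beta], while its derivative F' - beta is small
     along the segment. *)
  set (g := fun tau : R => (cpower beta (w tau) * / h + tau * (- beta))%C).
  assert (Hid : forall tau, cder (fun x : R => RtoC x) tau 1%C).
  { intros tau. split; simpl; [apply (@is_derive_id R_AbsRing) | apply @is_derive_const]. }
  assert (Hg : forall tau, 0 <= tau <= 1 -> cder g tau (F' (w tau) - beta)%C).
  { intros tau Ht. eapply cder_eq.
    - apply cder_plus.
      + apply (cder_mult (fun x => cpower beta (w x)) (fun _ => (/ h)%C)); [|apply cder_const].
        apply (cder_cpower beta w).
        * assert (B := re_le_Cmod (w tau - 1)).
          change (Re (w tau - 1)%C) with (Re (w tau) - 1) in B.
          generalize (Hw tau Ht) (Rle_abs (- (Re (w tau) - 1))). rewrite Rabs_Ropp. lra.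
        * apply (cder_plus (fun _ => 1%C)); [apply cder_const|].
          apply (cder_mult (fun x => RtoC x) (fun _ => h)); [apply Hid | apply cder_const].
      + apply (cder_mult (fun x => RtoC x) (fun _ => (- beta)%C)); [apply Hid | apply cder_const].
    - unfold F'. field. split; trivial.
      intros E. assert (B := Hw tau Ht). rewrite E in B.
      replace (0 - 1)%C with (- (1))%C in B by ring. rewrite Cmod_m1 in B. lra. }
  assert (Hb : forall tau, 0 <= tau <= 1 -> Cmod (F' (w tau) - beta) < eps / 2).
  { intros tau Ht. apply Q. generalize (Hw tau Ht). lra. }
  assert (E : ((cpower beta v - 1) / h - beta = g 1 - g 0)%C).
  { unfold g, w. replace (1 + 1 * h)%C with v by (unfold h; ring).
    replace (1 + 0 * h)%C with (RtoC 1) by ring. rewrite cpower_1. field; trivial. }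
  rewrite E. eapply Rle_lt_trans; [apply Cmod_le_abs|].
  change (Rabs (Re (g 1) - Re (g 0)) + Rabs (Im (g 1) - Im (g 0)) < eps).
  assert (Rabs (Re (g 1) - Re (g 0)) < eps / 2).
  { apply (is_derive_increment_lt (fun x => Re (g x)) (fun x => Re (F' (w x) - beta)%C)).
    - intros x Hx. apply (Hg x Hx).
    - intros x Hx. eapply Rle_lt_trans; [apply re_le_Cmod | now apply Hb]. }
  assert (Rabs (Im (g 1) - Im (g 0)) < eps / 2).
  { apply (is_derive_increment_lt (fun x => Im (g x)) (fun x => Im (F' (w x) - beta)%C)).
    - intros x Hx. apply (Hg x Hx).
    - intros x Hx. eapply Rle_lt_trans; [apply im_le_Cmod | now apply Hb]. }
  lra.
Qed.

(** * Roots of unity, long division and sectors *)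

Lemma cexp_plus (v w : C) : cexp (v + w) = (cexp v * cexp w)%C.
Proof.
  unfold cexp. change (Re (v + w)%C) with (Re v + Re w). change (Im (v + w)%C) with (Im v + Im w).
  rewrite exp_plus, cos_plus, sin_plus.
  apply injective_projections; simpl; ring.
Qed.

Lemma Cmod_cexp (w : C) : Cmod (cexp w) = exp (Re w).
Proof.
  unfold cexp, Cmod; simpl.
  assert (H := sin2_cos2 (Im w)). unfold Rsqr in H. assert (P := exp_pos (Re w)).
  rewrite <- (sqrt_square (exp (Re w))) at 5 by lra. f_equal.
  set (c := cos (Im w)) in *. set (d := sin (Im w)) in *.
  replace (exp (Re w) * c * (exp (Re w) * c * 1) + exp (Re w) * d * (exp (Re w) * d * 1))
    with (exp (Re w) * exp (Re w) * (d * d + c * c)) by ring.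
  rewrite H; ring.
Qed.

Lemma cexp_neq_0 (w : C) : cexp w <> 0%C.
Proof. apply Cmod_gt_0. rewrite Cmod_cexp. apply exp_pos. Qed.

Lemma cexp_0 : cexp 0 = 1%C.
Proof. unfold cexp; simpl. rewrite exp_0, cos_0, sin_0. apply injective_projections; simpl; ring. Qed.

Lemma cexp_pow (w : C) (n : nat) : (cexp w ^ n = cexp (INR n * w))%C.
Proof.
  induction n as [|n IH].
  - simpl. now rewrite Cmult_0_l, cexp_0.
  - rewrite Cpow_S, IH, <- cexp_plus, S_INR, RtoC_plus. f_equal. ring.
Qed.

Lemma cexp_period (s t : R) (n : nat) : cexp (s, t + 2 * INR n * PI) = cexp (s, t).
Proof. unfold cexp; simpl. now rewrite cos_period, sin_period. Qed.

Fixpoint csum (f : nat -> C) (n : nat) : C :=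
  match n with O => 0%C | S m => (csum f m + f m)%C end.

Lemma csum_ext (f g : nat -> C) (n : nat) :
  (forall k, (k < n)%nat -> f k = g k) -> csum f n = csum g n.
Proof. induction n as [|n IH]; intros H; simpl; trivial.
  rewrite IH; [rewrite H; [reflexivity | lia] | intros; apply H; lia].
Qed.

Lemma csum_plus (f g : nat -> C) (n : nat) :
  csum (fun k => f k + g k)%C n = (csum f n + csum g n)%C.
Proof. induction n as [|n IH]; simpl; [ring | rewrite IH; ring]. Qed.

Lemma csum_scal (c : C) (f : nat -> C) (n : nat) :
  csum (fun k => c * f k)%C n = (c * csum f n)%C.
Proof. induction n as [|n IH]; simpl; [ring | rewrite IH; ring]. Qed.

Lemma csum_exchange (f : nat -> nat -> C) (m n : nat) :
  csum (fun j => csum (fun k => f j k) n) m = csum (fun k => csum (fun j => f j k) m) n.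
Proof.
  induction m as [|m IH]; simpl.
  - induction n as [|n IHn]; simpl; [reflexivity | rewrite <- IHn; ring].
  - now rewrite csum_plus, IH.
Qed.

Lemma csum_first (f : nat -> C) (n : nat) :
  (0 < n)%nat -> (forall k, (0 < k < n)%nat -> f k = 0%C) -> csum f n = f 0%nat.
Proof.
  destruct n as [|n]; [lia|]. intros _. induction n as [|n IH]; intros H.
  - simpl; ring.
  - change (csum f (S n) + f (S n) = f 0%nat)%C. rewrite IH, (H (S n)); [ring | lia|].
    intros k Hk; apply H; lia.
Qed.

Lemma csum_const (c : C) (n : nat) : csum (fun _ => c) n = (INR n * c)%C.
Proof.
  induction n as [|n IH].
  - simpl; ring.
  - change (csum (fun _ => c) n + c = INR (S n) * c)%C. rewrite IH, S_INR, RtoC_plus. ring.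
Qed.

Lemma csum_geom (w : C) (n : nat) : ((w - 1) * csum (fun k => w ^ k) n = w ^ n - 1)%C.
Proof. induction n as [|n IH]; simpl; [ring | rewrite Cmult_plus_distr_l, IH; ring]. Qed.

(** With x = pi j / n strictly between 0 and pi, the real part is 1 - 2 sin(x)^2 < 1. *)
Lemma root_of_unity_neq_1 (n j : nat) :
  (0 < j < n)%nat -> cexp (0, 2 * PI * INR j / INR n) <> 1%C.
Proof.
  intros Hj E. assert (PI0 := PI_RGT_0).
  assert (0 < INR j) by (apply lt_0_INR; lia).
  assert (INR j < INR n) by (apply lt_INR; lia).
  set (x := PI * (INR j / INR n)).
  assert (Hx : 0 < x < PI).
  { assert (0 < INR j / INR n < 1).
    { split; [apply Rdiv_lt_0_compat; lra | apply -> Rdiv_lt_1; lra]. }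
    unfold x. nra. }
  apply (f_equal (fun w => fst w)) in E. unfold cexp in E; simpl in E.
  rewrite exp_0, Rmult_1_l in E.
  replace (2 * PI * INR j / INR n) with (2 * x) in E by (unfold x; field; lra).
  rewrite cos_2a_sin in E.
  assert (Hs := sin_gt_0 x (proj1 Hx) (proj2 Hx)). nra.
Qed.

(** Up to a constant factor this is a geometric sum whose ratio w satisfies w^n = 1 and w <> 1. *)
Lemma csum_roots (s t : R) (n j : nat) :
  (0 < j < n)%nat -> csum (fun k => cexp (s, (t + 2 * PI * INR k / INR n)%R) ^ j)%C n = 0%C.
Proof.
  intros Hj.
  assert (Hn : 0 < INR n) by (apply lt_0_INR; lia).
  set (w := cexp (0, 2 * PI * INR j / INR n)).
  rewrite (csum_ext _ (fun k => cexp ((INR j * s)%R, (INR j * t)%R) * w ^ k)%C).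
  2: { intros k _. unfold w. rewrite !cexp_pow, <- cexp_plus. f_equal.
       apply injective_projections; simpl; field; lra. }
  rewrite csum_scal.
  assert (E : (csum (fun k => w ^ k) n = 0)%C).
  { assert (G := csum_geom w n).
    assert (W : (w ^ n = 1)%C).
    { unfold w. rewrite cexp_pow.
      transitivity (cexp (0, 0 + 2 * INR j * PI)); [|rewrite cexp_period; exact cexp_0].
      f_equal. apply injective_projections; simpl; field; lra. }
    assert (N : (w - 1)%C <> 0%C).
    { intros E. apply (root_of_unity_neq_1 n j Hj). fold w.
      replace w with (w - 1 + 1)%C by ring. rewrite E; ring. }
    rewrite W in G. replace (csum (fun k => w ^ k)%C n) with (/ (w - 1) * ((w - 1) * csum (fun k => w ^ k) n))%C
      by (field; trivial). rewrite G. ring. }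
change (Cpow w) with (fun k => (w ^ k)%C). rewrite E; ring.
Qed.

(** Long division of power series: [remainder b g m] is the series R_m with b = g * (q_0 + ... + q_(m-1) z^(m-1)) + z^m R_m. *)
Fixpoint remainder (b g : nat -> C) (m : nat) : nat -> C :=
  match m with
  | O => b
  | S l => fun k => (remainder b g l (S k) - remainder b g l 0%nat * g (S k))%C
  end.

(** For [g] with constant term 1 this is the m-th Taylor coefficient of the quotient of the two
    series. *)
Definition quot (b g : nat -> C) (m : nat) : C := remainder b g m 0%nat.

(** At k = 0 this is the convolution recursion obtained by comparing coefficients in b = g p. *)
Lemma remainder_eq (b g : nat -> C) (m k : nat) :
  remainder b g m k = (b (k + m)%nat - csum (fun j => quot b g j * g (k + m - j)%nat) m)%C.
Proof.
  revert k. induction m as [|m IH]; intros k; simpl.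
  - rewrite Nat.add_0_r. ring.
  - rewrite IH. replace (k + S m)%nat with (S k + m)%nat by lia.
    replace (S k + m - m)%nat with (S k) by lia. unfold quot at 3. ring.
Qed.

Lemma subexp_remainder (b g : nat -> C) (m : nat) :
  subexp b -> subexp g -> subexp (remainder b g m).
Proof.
  intros Hb Hg. induction m as [|m IH]; trivial. simpl.
  apply (subexp_lin (fun k => remainder b g m (S k)) (fun k => g (S k)));
    now apply subexp_shift.
Qed.

(** The quotient is expanded only to finite order, with an explicit power series as remainder, one
    division step per induction step. *)
Lemma PS_division (b g : nat -> C) (m : nat) (z : C) :
  subexp b -> subexp g -> g 0%nat = 1%C -> Cmod z < 1 ->
  (PS b z = PS g z * csum (fun j => quot b g j * z ^ j) m + z ^ m * PS (remainder b g m) z)%C.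
Proof.
  intros Hb Hg g0 Hz. induction m as [|m IH].
  - simpl; ring.
  - rewrite IH. set (R := remainder b g m). change (csum (fun j => quot b g j * z ^ j)%C (S m))
      with (csum (fun j => quot b g j * z ^ j)%C m + quot b g m * z ^ m)%C.
    assert (HR : subexp R) by now apply subexp_remainder.
    assert (E : (PS R z - quot b g m * PS g z = z * PS (remainder b g (S m)) z)%C).
    { rewrite <- (PS_lin R g _ z HR Hg Hz), (PS_shift _ z (subexp_lin R g _ HR Hg) Hz).
      rewrite g0. unfold quot at 1; fold R. simpl. fold R. unfold quot; fold R. ring. }
    replace (PS R z) with (quot b g m * PS g z + z * PS (remainder b g (S m)) z)%C
      by (rewrite <- E; ring).
    simpl; ring.
Qed.

(** For w of argument t the last two inequalities say sin (A2 - t) > 0 and sin (A1 + t) > 0. Written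
    as an intersection of half-planes through 0, the sector is visibly closed under sums and
    positive multiples. *)
Definition sector (A1 A2 : R) (w : C) : Prop :=
  0 < Re w /\ 0 < Re w * sin A2 - Im w * cos A2 /\ 0 < Re w * sin A1 + Im w * cos A1.

Lemma sector_csum (A1 A2 : R) (f : nat -> C) (n : nat) :
  (forall k, sector A1 A2 (f k)) -> sector A1 A2 (csum f (S n)).
Proof.
  intros H. induction n as [|n IH].
  - change (sector A1 A2 (0 + f 0%nat)%C). now rewrite Cplus_0_l.
  - change (sector A1 A2 (csum f (S n) + f (S n))%C).
    destruct IH as [I1 [I2 I3]], (H (S n)) as [J1 [J2 J3]].
    set (u := csum f (S n)) in *. set (v := f (S n)) in *.
    unfold sector. change (Re (u + v)%C) with (Re u + Re v).
    change (Im (u + v)%C) with (Im u + Im v). repeat split; lra.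
Qed.

Lemma sector_scal (A1 A2 c : R) (w : C) : 0 < c -> sector A1 A2 w -> sector A1 A2 (c * w)%C.
Proof.
  intros Hc [H1 [H2 H3]]. unfold sector.
  replace (Re (c * w)%C) with (c * Re w) by (unfold Re; simpl; ring).
  replace (Im (c * w)%C) with (c * Im w) by (unfold Im; simpl; ring).
  repeat split; nra.
Qed.

Lemma sector_of_arg (A1 A2 : R) (w : C) (t : R) :
  0 < A1 <= PI / 2 -> 0 < A2 <= PI / 2 -> is_Arg w t -> - A1 < t < A2 -> sector A1 A2 w.
Proof.
  intros H1 H2 [w0 [_ Ew]] Ht. apply Cmod_gt_0 in w0.
  set (r := Cmod w) in *.
  assert (Er : Re w = r * cos t) by (rewrite Ew; unfold Re; simpl; ring).
  assert (Ei : Im w = r * sin t) by (rewrite Ew; unfold Im; simpl; ring).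
  unfold sector. rewrite Er, Ei.
  assert (P1 := cos_gt_0 t). assert (P2 := sin_gt_0 (A2 - t)). assert (P3 := sin_gt_0 (A1 + t)).
  rewrite sin_minus in P2. rewrite sin_plus in P3.
  assert (PI0 := PI_RGT_0).
  repeat split.
  - apply Rmult_lt_0_compat; [lra | apply P1; lra].
  - replace (r * cos t * sin A2 - r * sin t * cos A2) with (r * (sin A2 * cos t - cos A2 * sin t)) by ring.
    apply Rmult_lt_0_compat; [lra | apply P2; lra].
  - replace (r * cos t * sin A1 + r * sin t * cos A1) with (r * (sin A1 * cos t + cos A1 * sin t)) by ring.
    apply Rmult_lt_0_compat; [lra | apply P3; lra].
Qed.

(** Multiplying the linear inequalities by cos t / Re w gives sin (A2 - t) > 0 and sin (A1 + t) > 0.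
    Both angles exceed - pi, and the sine is nonpositive between - pi and 0, so both angles are
    positive. *)
Lemma sector_clog (A1 A2 : R) (w : C) :
  0 < A1 <= PI / 2 -> 0 < A2 <= PI / 2 -> sector A1 A2 w -> - A1 < Im (clog w) < A2.
Proof.
  intros H1 H2 [S1 [S2 S3]]. change (Im (clog w)) with (atan (Im w / Re w)).
  set (t := atan (Im w / Re w)).
  assert (Bt : - PI / 2 < t < PI / 2) by apply atan_bound.
  assert (Pc : 0 < cos t) by (apply cos_gt_0; lra).
  assert (Et : sin t = Im w / Re w * cos t).
  { assert (T : tan t = Im w / Re w) by apply tan_atan. rewrite <- T. unfold tan. field; lra. }
  assert (K2 : 0 < sin (A2 - t)).
  { rewrite sin_minus, Et.
    replace (sin A2 * cos t - cos A2 * (Im w / Re w * cos t))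
      with ((Re w * sin A2 - Im w * cos A2) * (cos t / Re w)) by (field; lra).
    apply Rmult_lt_0_compat; trivial. now apply Rdiv_lt_0_compat. }
  assert (K1 : 0 < sin (A1 + t)).
  { rewrite sin_plus, Et.
    replace (sin A1 * cos t + cos A1 * (Im w / Re w * cos t))
      with ((Re w * sin A1 + Im w * cos A1) * (cos t / Re w)) by (field; lra).
    apply Rmult_lt_0_compat; trivial. now apply Rdiv_lt_0_compat. }
  assert (N : forall x, - PI < x -> 0 < sin x -> 0 < x).
  { intros x Hx Hs. apply Rnot_le_lt. intros Hle.
    assert (0 <= sin (- x)) by (apply sin_ge_0; lra). rewrite sin_neg in *. lra. }
  assert (0 < A2 - t) by (apply N; trivial; lra).
  assert (0 < A1 + t) by (apply N; trivial; lra). lra.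
Qed.

(** The point - exp (2 i phi) is the mirror image of 1 in the boundary line of the half-plane
    bisected by exp (i phi), so points of the half-plane are nearer to 1. Quantitatively, the
    squared distances differ by 4 exp (Re w) cos phi cos (Im w - phi). *)
Lemma half_plane_to_disc (w : C) (phi : R) :
  0 < cos phi -> 0 < cos (Im w - phi) ->
  (cexp w + cexp (0%R, (2 * phi)%R))%C <> 0%C /\
  Cmod (cexp w - 1) <= Cmod (cexp w + cexp (0, 2 * phi)).
Proof.
  intros Hp Hw.
  assert (P := exp_pos (Re w)). set (e := exp (Re w)) in *. set (y := Im w) in *.
  assert (E : Cmod (cexp w + cexp (0, 2 * phi)) ^ 2 - Cmod (cexp w - 1) ^ 2
          = 4 * e * cos phi * cos (y - phi)).
  { rewrite !Cmod2_alt.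
    replace (Re (cexp w + cexp (0%R, (2 * phi)%R))%C) with (e * cos y + cos (2 * phi))
      by (unfold cexp; simpl; rewrite exp_0; unfold e, y; ring).
    replace (Im (cexp w + cexp (0%R, (2 * phi)%R))%C) with (e * sin y + sin (2 * phi))
      by (unfold cexp; simpl; rewrite exp_0; unfold e, y; ring).
    replace (Re (cexp w - 1)%C) with (e * cos y - 1) by (unfold cexp; simpl; unfold e, y; ring).
    replace (Im (cexp w - 1)%C) with (e * sin y) by (unfold cexp; simpl; unfold e, y; ring).
    rewrite cos_minus, cos_2a, sin_2a.
    assert (T := sin2_cos2 phi). unfold Rsqr in T.
    assert (U : cos phi * cos phi = 1 - sin phi * sin phi) by lra.
    set (c := cos phi) in *. set (d := sin phi) in *.
    transitivity (2 * e * (cos y * (1 + (c * c - d * d)) + sin y * (2 * d * c))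
       + ((c * c + d * d) ^ 2 - 1)); [ring|].
    replace (c * c + d * d) with 1 by lra. 
    replace (1 + (c * c - d * d)) with (2 * c * c) by lra. ring. }
  assert (Q : 0 < 4 * e * cos phi * cos (y - phi)) by (repeat apply Rmult_lt_0_compat; lra).
  assert (N := Cmod_ge_0 (cexp w - 1)).
  assert (M := Cmod_ge_0 (cexp w + cexp (0, 2 * phi))).
  split.
  - intros Z. rewrite Z, Cmod_0 in E. nra.
  - nra.
Qed.

Lemma Cmod_1_plus_cexp (phi : R) : 0 < cos phi -> Cmod (1 + cexp (0, 2 * phi)) = 2 * cos phi.
Proof.
  intros H. rewrite <- (Rabs_pos_eq (Cmod _)) by apply Cmod_ge_0.
  rewrite <- (Rabs_pos_eq (2 * cos phi)) by lra.
  apply Rsqr_eq_abs_0. unfold Rsqr.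
  replace (Cmod (1 + cexp (0, 2 * phi)) * Cmod (1 + cexp (0, 2 * phi)))
    with (Cmod (1 + cexp (0, 2 * phi)) ^ 2) by ring.
  rewrite Cmod2_alt.
  replace (Re (1 + cexp (0%R, (2 * phi)%R))%C) with (1 + cos (2 * phi))
    by (unfold cexp; simpl; rewrite exp_0; ring).
  replace (Im (1 + cexp (0%R, (2 * phi)%R))%C) with (sin (2 * phi))
    by (unfold cexp; simpl; rewrite exp_0; ring).
  rewrite cos_2a, sin_2a. assert (T := sin2_cos2 phi). unfold Rsqr in T.
  set (c := cos phi) in *. set (d := sin phi) in *.
  assert (U : d * d = 1 - c * c) by lra.
  replace ((1 + (c * c - d * d)) ^ 2 + (2 * d * c) ^ 2)
    with ((1 + c * c - d * d) ^ 2 + 4 * (d * d) * (c * c)) by ring.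
  rewrite U; ring.
Qed.

(** * The coefficient bound of Rogosinski *)

Lemma ex_hol_csum (W : nat -> R -> R -> C) (n : nat) :
  (forall k, ex_hol (W k)) -> ex_hol (fun s t => csum (fun k => W k s t) n).
Proof.
  intros H. induction n as [|n IH]; simpl; [apply ex_hol_const | now apply ex_hol_plus].
Qed.

Lemma ulim_csum_0 (W : nat -> R -> R -> C) (n : nat) :
  (forall k, ulim (W k) 0) -> ulim (fun s t => csum (fun k => W k s t) n) 0.
Proof.
  intros H. induction n as [|n IH]; simpl; [apply ulim_const|].
  rewrite <- (Cplus_0_l 0). now apply ulim_plus.
Qed.

Lemma Cmod_cexp_lt_1 (s t : R) : s < 0 -> Cmod (cexp (s, t)) < 1.
Proof.
  intros Hs. rewrite Cmod_cexp. simpl. rewrite <- exp_0. now apply exp_increasing.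
Qed.

(** The modulus depends on s alone, so the angle may be any function of t and the threshold is ln
    eps. *)
Lemma ulim_cexp (h : R -> R) : ulim (fun s t => cexp (s, h t)) 0.
Proof.
  intros eps He. exists (Rmin (-1) (ln eps)). split; [generalize (Rmin_l (-1) (ln eps)); lra|].
  intros s t Hs. replace (cexp (s, h t) - 0)%C with (cexp (s, h t)) by ring.
  rewrite Cmod_cexp. simpl. rewrite <- (exp_ln eps He). apply exp_increasing.
  generalize (Rmin_r (-1) (ln eps)); lra.
Qed.

Section CoefficientBound.

Variables (A1 A2 : R) (b g : nat -> C).
Hypotheses (HA1 : 0 < A1 <= PI / 2) (HA2 : 0 < A2 <= PI / 2).
Hypotheses (Hb : subexp b) (Hg : subexp g) (b0 : b 0%nat = 1%C) (g0 : g 0%nat = 1%C).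
Hypothesis Hg0 : forall z, Cmod z < 1 -> PS g z <> 0%C.
Hypothesis Hsec : forall z, Cmod z < 1 -> z <> 0%C -> sector A1 A2 (PS b z * / PS g z)%C.

(** These satisfy beta A2 - phi = pi / 2 and - beta A1 - phi = - pi / 2: multiplication by [beta]
    carries the interval of arguments onto one of length pi centred at [phi]. *)
Let phi := PI * (A2 - A1) / (2 * (A1 + A2)).
Let beta := PI / (A1 + A2).

Variable n : nat.
Hypothesis Hn : (0 < n)%nat.

Let rot (k : nat) (s t : R) : C := cexp (s, t + 2 * PI * INR k / INR n).
Let P (z : C) : C := (PS b z * / PS g z)%C.

(* Only the coefficients of index divisible by n survive the average over the n-th roots of unity; by convexity it still takes values in the sector. *)
Let Q (s t : R) : C := (/ INR n * csum (fun k => P (rot k s t)) n)%C.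

Let INRn : 0 < INR n.
Proof. now apply lt_0_INR. Qed.

Let Q_sector (s t : R) : s < 0 -> sector A1 A2 (Q s t).
Proof.
  intros Hs. unfold Q. rewrite <- RtoC_inv by lra. apply sector_scal; [now apply Rinv_0_lt_compat|].
  destruct n as [|m]; [lia|]. apply sector_csum. intros k. apply Hsec.
  - now apply Cmod_cexp_lt_1.
  - apply cexp_neq_0.
Qed.

Let ex_hol_rot (k : nat) : ex_hol (rot k).
Proof.
  apply ex_hol_exp. eapply ex_hol_ext; [|apply (ex_hol_id 1 (2 * PI * INR k / INR n))].
  intros s t; simpl. now rewrite !Rmult_1_l.
Qed.

Let ex_hol_Q : ex_hol Q.
Proof.
  apply ex_hol_mult; [apply ex_hol_const|]. apply ex_hol_csum. intros k.
  apply ex_hol_mult; [|apply ex_hol_inv].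
  - apply ex_hol_PS; trivial. intros s t Hs. now apply Cmod_cexp_lt_1.
  - intros s t Hs. now apply Hg0, Cmod_cexp_lt_1.
  - apply ex_hol_PS; trivial. intros s t Hs. now apply Cmod_cexp_lt_1.
Qed.

Let Q_period (s t : R) : Q s (t + 2 * PI) = Q s t.
Proof.
  unfold Q. f_equal. apply csum_ext. intros k _. f_equal. unfold rot.
  rewrite <- (cexp_period s (t + 2 * PI * INR k / INR n) 1). f_equal. f_equal. simpl. ring.
Qed.

(** What remains of [P] after its terms up to order n, divided by z^n; the leftover factor z makes
    it vanish at the origin. *)
Let tail (z : C) : C := (z * (PS (remainder b g (S n)) z * / PS g z))%C.

Let quot_0 : quot b g 0 = 1%C.
Proof. exact b0. Qed.

(** The exponential is z^(-n), written with [+ 0] to match the shape of [ex_hol_id]. *)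
Let Q_expansion (s t : R) : s < 0 ->
  ((Q s t - 1) * cexp (((- INR n) * s)%R, ((- INR n) * t + 0)%R)
   = quot b g n + / INR n * csum (fun k => tail (rot k s t)) n)%C.
Proof.
  intros Hs.
  assert (Nn : RtoC (INR n) <> 0%C) by (intros E; apply RtoC_inj in E; lra).
  set (z := cexp (s, t)).
  (* Rotation by an n-th root of unity leaves z^n fixed. *)
  assert (Ek : forall k, (rot k s t ^ n = z ^ n)%C).
  { intros k. unfold rot, z. rewrite !cexp_pow.
    replace (INR n * (s, (t + 2 * PI * INR k / INR n)%R))%C
      with ((INR n * s)%R, (INR n * t + 2 * INR k * PI)%R).
    - rewrite cexp_period. f_equal. apply injective_projections; simpl; ring.
    - apply injective_projections; simpl; field; lra. }
  assert (EP : forall k, P (rot k s t) =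
     (csum (fun j => quot b g j * rot k s t ^ j) (S n) + z ^ n * tail (rot k s t))%C).
  { intros k. assert (Hz : Cmod (rot k s t) < 1) by now apply Cmod_cexp_lt_1.
    unfold P, tail. rewrite (PS_division b g (S n) _ Hb Hg g0 Hz).
    rewrite <- (Ek k), Cpow_S. field. now apply Hg0. }
  assert (EQ : (csum (fun k => P (rot k s t)) n =
    INR n * (1 + quot b g n * z ^ n) + z ^ n * csum (fun k => tail (rot k s t)) n)%C).
  { rewrite (csum_ext _ _ n (fun k _ => EP k)), csum_plus, csum_scal. f_equal.
    rewrite csum_exchange.
    (* The term j = n is split off; among the indices below n only j = 0 survives the sum over the
       roots. *)
    change (csum (fun j => csum (fun k => quot b g j * rot k s t ^ j) n) n
            + csum (fun k => quot b g n * rot k s t ^ n) n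
            = INR n * (1 + quot b g n * z ^ n))%C.
    rewrite csum_first; trivial.
    - rewrite (csum_ext _ (fun _ => 1%C) n).
      2: { intros k _. rewrite quot_0. simpl. ring. }
      rewrite (csum_ext (fun k => quot b g n * rot k s t ^ n)%C (fun _ => quot b g n * z ^ n)%C n).
      2: { intros k _. now rewrite Ek. }
      rewrite !csum_const. ring.
    - intros j Hj. rewrite csum_scal. unfold rot. rewrite csum_roots; trivial. ring. }
  assert (Ez : (z ^ n * cexp (((- INR n) * s)%R, ((- INR n) * t + 0)%R) = 1)%C).
  { unfold z. rewrite cexp_pow, <- cexp_plus, <- cexp_0. f_equal.
    apply injective_projections; simpl; ring. }
  unfold Q. rewrite EQ.
  set (c := csum (fun k => tail (rot k s t)) n) in *.
  set (e := cexp (((- INR n) * s)%R, ((- INR n) * t + 0)%R)) in *.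
  replace ((/ INR n * (INR n * (1 + quot b g n * z ^ n) + z ^ n * c) - 1) * e)%C
    with ((z ^ n * e) * (quot b g n + / INR n * c))%C by (field; trivial).
  rewrite Ez. ring.
Qed.

Let ulim_Q_expansion :
  ulim (fun s t => (Q s t - 1) * cexp (((- INR n) * s)%R, ((- INR n) * t + 0)%R))%C (quot b g n).
Proof.
  apply ulim_ext with (fun s t => quot b g n + / INR n * csum (fun k => tail (rot k s t)) n)%C.
  { intros s t Hs. symmetry. now apply Q_expansion. }
  replace (quot b g n) with (quot b g n + / INR n * 0)%C at 1 by ring.
  apply ulim_plus; [apply ulim_const|]. apply ulim_mult; [apply ulim_const|].
  apply ulim_csum_0. intros k.
  assert (C0 : Cmod 0 < 1) by (rewrite Cmod_0; lra).
  set (U := fun z => (PS (remainder b g (S n)) z * / PS g z)%C).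
  rewrite <- (Cmult_0_l (U 0)).
  apply (ulim_mult (rot k) (fun s t => U (rot k s t))).
  - apply ulim_cexp.
  - apply (ulim_comp U); [|apply ulim_cexp].
    assert (Hr := subexp_remainder b g (S n) Hb Hg).
    apply ccont_mult; [now apply ccont_PS|].
    intros eps He.
    destruct (ccont_inv (PS g 0) (Hg0 _ C0) eps He) as [d [Hd K]].
    destruct (ccont_PS g 0 Hg C0 d Hd) as [d' [Hd' K']].
    exists d'. split; trivial. intros v Hv. now apply K, K'.
Qed.

(** (Q - 1) / z^n converges and z^n tends to 0, so their product Q - 1 tends to 0. *)
Let ulim_Q : ulim Q 1.
Proof.
  apply ulim_ext with (fun s t =>
    (Q s t - 1) * cexp (((- INR n) * s)%R, ((- INR n) * t + 0)%R) * cexp (s, t) ^ n + 1)%C.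
  { intros s t _. rewrite cexp_pow, <- Cmult_assoc, <- cexp_plus.
    replace (((- INR n) * s)%R, ((- INR n) * t + 0)%R) with (- (INR n * (s, t)))%C
      by (apply injective_projections; simpl; ring).
    replace (- (INR n * (s, t)) + INR n * (s, t))%C with (RtoC 0) by ring.
    rewrite cexp_0. ring. }
  replace (RtoC 1) with (quot b g n * 0 + 1)%C at 1 by ring.
  apply ulim_plus; [|apply ulim_const]. apply ulim_mult; [exact ulim_Q_expansion|].
  (* Positivity of n supplies at least one factor z, without which the power would not tend to 0. *)
  destruct n as [|m]; [lia|].
  replace (RtoC 0) with (0 ^ S m)%C by (simpl; ring).
  generalize (S m); intros q. induction q as [|q IH]; simpl; [apply ulim_const|].
  apply ulim_mult; trivial. apply (ulim_cexp (fun t => t)).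
Qed.

(** Since both angles are positive, |A2 - A1| < A1 + A2, hence |phi| < pi / 2. *)
Let cos_phi : 0 < cos phi.
Proof.
  assert (PI0 := PI_RGT_0).
  assert (E : - (PI / 2) < phi < PI / 2).
  { unfold phi. split.
    - apply Rmult_lt_reg_r with (2 * (A1 + A2)); [lra|].
      replace (PI * (A2 - A1) / (2 * (A1 + A2)) * (2 * (A1 + A2))) with (PI * (A2 - A1)) by (field; lra).
      nra.
    - apply Rmult_lt_reg_r with (2 * (A1 + A2)); [lra|].
      replace (PI * (A2 - A1) / (2 * (A1 + A2)) * (2 * (A1 + A2))) with (PI * (A2 - A1)) by (field; lra).
      nra. }
  apply cos_gt_0; lra.
Qed.

Let rotated_half_plane (s t : R) : s < 0 -> 0 < cos (Im (beta * clog (Q s t))%C - phi).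
Proof.
  intros Hs. assert (PI0 := PI_RGT_0).
  destruct (sector_clog A1 A2 _ HA1 HA2 (Q_sector s t Hs)) as [L1 L2].
  replace (Im (beta * clog (Q s t))%C) with (beta * Im (clog (Q s t)))
    by (unfold Im; simpl; ring).
  set (y := Im (clog (Q s t))) in *.
  assert (B0 : 0 < beta) by (apply Rdiv_lt_0_compat; lra).
  assert (B1 : beta * A2 - phi = PI / 2) by (unfold beta, phi; field; lra).
  assert (B2 : beta * (- A1) - phi = - (PI / 2)) by (unfold beta, phi; field; lra).
  assert (beta * y < beta * A2) by now apply Rmult_lt_compat_l.
  assert (beta * (- A1) < beta * y) by now apply Rmult_lt_compat_l.
  apply cos_gt_0; lra.
Qed.

Let e2 := cexp (0, 2 * phi).

(* Cayley transform of the beta-th power of Q, divided by z^n: the Schwarz lemma in logarithmic coordinates. *)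
Let T (s t : R) : C :=
  ((cpower beta (Q s t) - 1) * / (cpower beta (Q s t) + e2)
   * cexp (((- INR n) * s)%R, ((- INR n) * t + 0)%R))%C.

Lemma quot_bound : Cmod (quot b g n) <= 2 * (A1 + A2) / PI * cos phi.
Proof.
  assert (PI0 := PI_RGT_0).
  assert (Hk := Cmod_1_plus_cexp phi cos_phi). fold e2 in Hk.
  assert (k0 : (1 + e2)%C <> 0%C) by (apply Cmod_gt_0; rewrite Hk; generalize cos_phi; lra).
  assert (HL : ulim T (beta * quot b g n * / (1 + e2))%C).
  (* Near the origin [T] factors into the slope of the power, the normalised increment of [Q] and a
     regular denominator, with limits [beta], the n-th coefficient and the inverse of 1 + e2. *)
  { apply ulim_ext with (fun s t =>
      pslope beta (Q s t) * ((Q s t - 1) * cexp (((- INR n) * s)%R, ((- INR n) * t + 0)%R))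
        * / (cpower beta (Q s t) + e2))%C.
    { intros s t _. unfold T. rewrite pslope_eq. ring. }
    apply ulim_mult; [apply ulim_mult; [|exact ulim_Q_expansion]|].
    - replace (RtoC beta) with (pslope beta 1).
      + apply (ulim_comp (pslope beta)); [apply ccont_pslope | exact ulim_Q].
      + unfold pslope. now destruct (Ceq_dec 1 1).
    - rewrite <- (cpower_1 beta) at 1.
      apply (ulim_comp Cinv (fun s t => cpower beta (Q s t) + e2)%C).
      + apply ccont_inv. now rewrite cpower_1.
      + apply ulim_plus; [|apply ulim_const].
        apply (ulim_comp (cpower beta)); [apply ccont_cpower; simpl; lra | exact ulim_Q]. }
  assert (HT : Cmod (beta * quot b g n * / (1 + e2)) <= 1).
  { apply (ulim_Cmod_bound T _ (INR n)); trivial.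
    - assert (HG : ex_hol (fun s t => cpower beta (Q s t))).
      { apply ex_hol_exp, ex_hol_mult; [apply ex_hol_const|]. apply ex_hol_log; trivial.
        intros s t Hs. apply (Q_sector s t Hs). }
      apply ex_hol_mult; [apply ex_hol_mult|].
      + apply ex_hol_plus; trivial. apply ex_hol_const.
      + apply ex_hol_inv.
        * intros s t Hs.
          apply (half_plane_to_disc _ phi cos_phi (rotated_half_plane s t Hs)).
        * apply ex_hol_plus; trivial. apply ex_hol_const.
      + apply ex_hol_exp, ex_hol_id.
    (* When t grows by 2 pi, the imaginary part of the exponent drops by 2 pi n, a multiple of the
       period. *)
    - intros s Hs. unfold T. rewrite <- (Q_period s 0), Rplus_0_l. f_equal.
      rewrite <- (cexp_period _ (- INR n * (2 * PI) + 0) n). f_equal. f_equal. ring.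
    - intros s t Hs. unfold T.
      destruct (half_plane_to_disc _ phi cos_phi (rotated_half_plane s t Hs)) as [H1 H2].
      fold e2 in H1, H2. change (cexp (beta * clog (Q s t))) with (cpower beta (Q s t)) in H1, H2.
      rewrite !Cmod_mult, Cmod_inv, Cmod_cexp; trivial. simpl.
      replace (- (INR n * s)) with (- INR n * s) by ring.
      apply Cmod_gt_0 in H1. assert (Pe := exp_pos (- INR n * s)).
      rewrite <- (Rmult_1_l (exp (- INR n * s))) at 2.
      apply Rmult_le_compat_r; [lra|].
      apply Rmult_le_reg_r with (Cmod (cpower beta (Q s t) + e2)); trivial.
      rewrite Rmult_assoc, Rinv_l; lra. }
  assert (B0 : 0 < beta) by (apply Rdiv_lt_0_compat; lra).
  rewrite !Cmod_mult, Cmod_inv, Hk, Cmod_R, Rabs_pos_eq in HT; trivial; [|lra].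
  assert (Cp := cos_phi).
  apply Rmult_le_reg_l with (beta * / (2 * cos phi)).
  - apply Rmult_lt_0_compat; trivial. apply Rinv_0_lt_compat; lra.
  - replace (beta * / (2 * cos phi) * (2 * (A1 + A2) / PI * cos phi)) with 1
      by (unfold beta; field; lra). lra.
Qed.

End CoefficientBound.

(** * The coefficients of f *)

Lemma sum_n_Re_Im (u : nat -> C) (n : nat) :
  sum_n (fun k => Re (u k)) n = Re (sum_n (G := C_NormedModule) u n) /\
  sum_n (fun k => Im (u k)) n = Im (sum_n (G := C_NormedModule) u n).
Proof.
  induction n as [|n [IH1 IH2]].
  - rewrite !sum_O. now split.
  - rewrite !sum_Sn, IH1, IH2. now split.
Qed.

(** Balls in C are products of coordinate balls, so a neighbourhood of a coordinate pulls back to a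
    neighbourhood of the limit. *)
Lemma is_series_C (u : nat -> C) (l : C) :
  is_series (K := C_AbsRing) (V := C_NormedModule) u l -> is_Cseries u l.
Proof.
  intros H. split; intros P [eps HP].
  - assert (K : locally l (fun z : C => P (Re z))).
    { exists eps. intros y [Hy _]. now apply HP. }
    apply H in K. revert K. unfold filtermap. apply filter_imp. intros n.
    intros K. rewrite <- (proj1 (sum_n_Re_Im u n)) in K. exact K.
  - assert (K : locally l (fun z : C => P (Im z))).
    { exists eps. intros y [_ Hy]. now apply HP. }
    apply H in K. revert K. unfold filtermap. apply filter_imp. intros n.
    intros K. rewrite <- (proj2 (sum_n_Re_Im u n)) in K. exact K.
Qed.

Lemma is_pseries_C (a : nat -> C) (z l : C) :
  is_pseries (K := C_AbsRing) (V := C_NormedModule) a z l ->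
  is_Cseries (fun k => a k * z ^ k)%C l.
Proof.
  intros H. apply is_series_C in H. eapply is_Cseries_ext; [|exact H].
  intros k. change (pow_n (K := C_AbsRing) z k * a k = a k * z ^ k)%C.
  apply Cmult_comm.
Qed.

Lemma series_terms_bounded (u : nat -> R) (l : R) :
  is_series u l -> exists M, forall k, Rabs (u k) <= M.
Proof.
  intros H. assert (L : is_lim_seq u 0) by (apply ex_series_lim_0; now exists l).
  apply is_lim_seq_Reals in L. destruct (maj_by_pos u) as [M [_ HM]].
  - now exists 0.
  - now exists M.
Qed.

(** Convergence at the real point r of the disc bounds the terms there, and these have modulus |a_k|
    r^k. *)
Lemma subexp_of_pseries (a : nat -> C) (f : C -> C) :
  (forall z : C, Cmod z < 1 -> is_pseries (K := C_AbsRing) (V := C_NormedModule) a z (f z)) ->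
  subexp a.
Proof.
  intros H r Hr.
  assert (Hz : Cmod r < 1) by (rewrite Cmod_R, Rabs_pos_eq; lra).
  destruct (is_pseries_C _ _ _ (H r Hz)) as [H1 H2].
  destruct (series_terms_bounded _ _ H1) as [M HM], (series_terms_bounded _ _ H2) as [N HN].
  exists (M + N). intros k.
  replace (Cmod (a k) * r ^ k) with (Cmod (a k * r ^ k)%C).
  - eapply Rle_trans; [apply Cmod_le_abs|]. generalize (HM k) (HN k). lra.
  - rewrite Cmod_mult, <- RtoC_pow, Cmod_R, Rabs_pos_eq; trivial. apply pow_le; lra.
Qed.

(** This links the power series to the derivative in which the class is defined, so that the
    argument condition can be applied to an explicit value. *)
Lemma is_derive_PS (a : nat -> C) (f : C -> C) (z : C) :
  subexp a -> (forall w, Cmod w < 1 -> f w = PS a w) -> Cmod z < 1 ->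
  is_derive (K := C_AbsRing) (V := C_NormedModule) f z (PS (dcoef a) z).
Proof.
  intros Ha Hf Hz.
  set (r := (Cmod z + 1) / 2).
  assert (P := Cmod_ge_0 z).
  assert (Hr : Cmod z < r /\ 0 < r < 1) by (unfold r; lra).
  destruct (PS_quad a r Ha (proj2 Hr)) as [K [HK Q]].
  split; [apply is_linear_scal_l|].
  intros x Hx. apply (is_filter_lim_locally_unique (V := AbsRing_NormedModule C_AbsRing)) in Hx.
  subst x. intros [eps He]. simpl.
  (* The first bound keeps w in the disc of radius r, the second makes K |w - z| <= eps; K + 1
     avoids dividing by zero. *)
  assert (Hd : 0 < Rmin (r - Cmod z) (eps / (K + 1))).
  { apply Rmin_pos; [lra | apply Rdiv_lt_0_compat; lra]. }
  exists (mkposreal _ Hd). intros w Hw. change (Cmod (w - z) < Rmin (r - Cmod z) (eps / (K + 1))) in Hw.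
  assert (M1 := Rmin_l (r - Cmod z) (eps / (K + 1))).
  assert (M2 := Rmin_r (r - Cmod z) (eps / (K + 1))).
  assert (Hwr : Cmod w <= r).
  { replace w with (w - z + z)%C by ring. eapply Rle_trans; [apply Cmod_triangle|]. lra. }
  change (Cmod (f w - f z - (w - z) * PS (dcoef a) z) <= eps * Cmod (w - z)).
  rewrite !Hf by (destruct Hr; lra). rewrite (Cmult_comm (w - z)).
  eapply Rle_trans; [apply Q; lra|].
  set (h := Cmod (w - z)) in *. assert (Ph : 0 <= h) by apply Cmod_ge_0.
  simpl. rewrite Rmult_1_r, <- Rmult_assoc. apply Rmult_le_compat_r; trivial.
  assert (E : (K + 1) * h <= (K + 1) * (eps / (K + 1))) by (apply Rmult_le_compat_l; lra).
  replace ((K + 1) * (eps / (K + 1))) with eps in E by (field; lra). lra.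
Qed.

(** * From the coefficient recursion to the product bound *)

Fixpoint rsum (f : nat -> R) (n : nat) : R :=
  match n with O => 0 | S m => rsum f m + f m end.

Lemma rsum_S_l (f : nat -> R) (n : nat) : rsum f (S n) = f 0%nat + rsum (fun k => f (S k)) n.
Proof.
  induction n as [|n IH]; [simpl; ring|].
  change (rsum f (S n) + f (S n) = f 0%nat + (rsum (fun k => f (S k)) n + f (S n))).
  rewrite IH; ring.
Qed.

Lemma rsum_rev (f : nat -> R) (n : nat) : rsum (fun k => f (n - k)%nat) n = rsum (fun k => f (S k)) n.
Proof.
  induction n as [|n IH]; trivial.
  rewrite rsum_S_l. simpl rsum at 2. rewrite <- IH, Nat.sub_0_r. simpl. ring.
Qed.

Lemma prod_from_snoc (h : nat -> R) (m l : nat) :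
  prod_from h m (S l) = prod_from h m l * h (m + l)%nat.
Proof.
  revert m. induction l as [|l IH]; intros m.
  - simpl. rewrite Nat.add_0_r. ring.
  - change (h m * prod_from h (S m) (S l) = h m * prod_from h (S m) l * h (m + S l)%nat).
    rewrite IH. replace (S m + l)%nat with (m + S l)%nat by lia. ring.
Qed.

Lemma cos_even_le (x y : R) : Rabs x <= Rabs y <= PI -> cos y <= cos x.
Proof.
  assert (E : forall u, cos (Rabs u) = cos u).
  { intros u. unfold Rabs. destruct (Rcase_abs u); trivial. apply cos_neg. }
  intros H. rewrite <- (E x), <- (E y). assert (P := Rabs_pos x).
  apply cos_decr_1; lra.
Qed.

(** The recursion gives m |a_(m+1)| <= B (|a_1| + ... + |a_m|). The partial sums therefore grow at
    most by the factor 1 + B / m at each step, so they stay below the product. *)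
Lemma coefficient_product_bound (B : R) (a q : nat -> C) :
  0 <= B -> a 1%nat = 1%C -> q 0%nat = 1%C ->
  (forall m, (0 < m)%nat -> Cmod (q m) <= B) ->
  (forall m, q m = INR (S m) * a (S m) - csum (fun j => q j * a (S (m - j))) m)%C ->
  forall m, Cmod (a (S (S m))) <=
    B / INR (S m) * prod_from (fun k => 1 + B / INR (k - 1)) 2 m.
Proof.
  intros HB a1 q0 Hq Hrec.
  set (A := fun k => Cmod (a k)).
  assert (Step : forall m, INR (S m) * A (S (S m)) <= B * rsum (fun k => A (S k)) (S m)).
  { intros m. set (N := S m).
    (* The term j = 0 equals a_(N+1); removing it turns the factor N + 1 of the recursion into N. *)
    assert (G : forall l, (l <= m)%nat ->
      Cmod (csum (fun j => q j * a (S (N - j)))%C (S l) - a (S N))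
        <= B * rsum (fun k => A (N - k)%nat) l).
    { induction l as [|l IH]; intros Hl.
      - replace (csum (fun j => q j * a (S (N - j)))%C 1 - a (S N))%C with (RtoC 0)
          by (simpl; unfold N; rewrite q0; ring).
        rewrite Cmod_0. simpl. lra.
      - specialize (IH ltac:(lia)).
        change (csum (fun j => q j * a (S (N - j)))%C (S (S l))) with
          (csum (fun j => q j * a (S (N - j)))%C (S l) + q (S l) * a (S (N - S l)))%C.
        change (rsum (fun k => A (N - k)%nat) (S l)) with
          (rsum (fun k => A (N - k)%nat) l + A (N - l)%nat).
        set (c := csum (fun j => q j * a (S (N - j)))%C (S l)) in *.
        replace (c + q (S l) * a (S (N - S l)) - a (S N))%C
          with ((c - a (S N)) + q (S l) * a (S (N - S l)))%C by ring.
        eapply Rle_trans; [apply Cmod_triangle|]. rewrite Cmod_mult.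
        replace (S (N - S l)) with (N - l)%nat by (unfold N; lia).
        assert (Cmod (q (S l)) * A (N - l)%nat <= B * A (N - l)%nat).
        { apply Rmult_le_compat_r; [apply Cmod_ge_0 | apply Hq; lia]. }
        unfold A in *. lra. }
    (* The summand [q N] stands for the last term j = N, since a_1 = 1. *)
    assert (E : (INR N * a (S N) =
       (csum (fun j => q j * a (S (N - j)))%C (S m) - a (S N)) + q N)%C).
    { rewrite (Hrec N). fold N. rewrite (S_INR N), RtoC_plus. ring. }
    assert (F : INR N * A (S N) = Cmod (INR N * a (S N))).
    { rewrite Cmod_mult, Cmod_R, Rabs_pos_eq; trivial. apply pos_INR. }
    rewrite F, E. eapply Rle_trans; [apply Cmod_triangle|].
    assert (G' := G m (Nat.le_refl m)). assert (Hq' := Hq N (Nat.lt_0_succ m)).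
    rewrite <- rsum_rev. fold N in G' |- *.
    change (rsum (fun k => A (N - k)%nat) N) with (rsum (fun k => A (N - k)%nat) m + A (N - m)%nat).
    replace (A (N - m)%nat) with 1; [lra|].
    unfold N. replace (S m - m)%nat with 1%nat by lia. unfold A. rewrite a1, Cmod_1. trivial. }
  assert (Sum : forall m, rsum (fun k => A (S k)) (S m) <= prod_from (fun k => 1 + B / INR (k - 1)) 2 m).
  { induction m as [|m IH].
    - simpl. unfold A. rewrite a1, Cmod_1. lra.
    - rewrite prod_from_snoc. replace (2 + m - 1)%nat with (S m) by lia.
      change (rsum (fun k => A (S k)) (S (S m))) with (rsum (fun k => A (S k)) (S m) + A (S (S m))).
      assert (P : 0 < INR (S m)) by (apply lt_0_INR; lia).
      specialize (Step m). set (R0 := rsum (fun k => A (S k)) (S m)) in *.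
      assert (A (S (S m)) <= B / INR (S m) * R0).
      { apply Rmult_le_reg_l with (INR (S m)); trivial.
        replace (INR (S m) * (B / INR (S m) * R0)) with (B * R0) by (field; lra). exact Step. }
      assert (0 <= B / INR (S m)) by now apply Rdiv_le_0_compat.
      apply Rle_trans with (R0 * (1 + B / INR (S m))); [lra|].
      apply Rmult_le_compat_r; lra. }
  intros m. assert (P : 0 < INR (S m)) by (apply lt_0_INR; lia).
  apply Rmult_le_reg_l with (INR (S m)); trivial.
  replace (INR (S m) * (B / INR (S m) * prod_from (fun k => 1 + B / INR (k - 1)) 2 m))
    with (B * prod_from (fun k => 1 + B / INR (k - 1)) 2 m) by (field; lra).
  eapply Rle_trans; [apply Step|]. now apply Rmult_le_compat_l.
Qed.

Lemma prod_from_ext (h k : nat -> R) (m l : nat) :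
  (forall i, h i = k i) -> prod_from h m l = prod_from k m l.
Proof.
  intros E. revert m. induction l as [|l IH]; intros m; simpl; trivial. now rewrite E, IH.
Qed.

Theorem theorem3p2 (alpha1 alpha2 : R) (f : C -> C) (a : nat -> C) :
  0 < alpha1 <= 1 -> 0 < alpha2 <= 1 ->
  (* f(z) = z + sum_{n>=2} a_n z^n on Delta (so a 0 = 0, a 1 = 1) *)
  (forall z : C, in_Delta z ->
     is_pseries (K := C_AbsRing) (V := C_NormedModule) a (z : C_AbsRing) (f z : C_NormedModule)) ->
  S_star_t alpha1 alpha2 f ->
  let theta := (alpha2 - alpha1) / (alpha2 + alpha1) in
  Cmod (a 2%nat) <= (alpha1 + alpha2) * cos (theta / 2) /\
  forall n : nat, (3 <= n)%nat ->
    Cmod (a n) <=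
      (alpha1 + alpha2) / INR (n - 1) * cos (theta / 2) *
      prod_from (fun k => 1 + (alpha1 + alpha2) / INR (k - 1) * cos (theta / 2))
                2 (n - 2).
Proof.
  intros H1 H2 Hser [_ [Hf0 [Hd0 Hstar]]] theta.
  assert (PI0 := PI_RGT_0).
  assert (Ha := subexp_of_pseries a f Hser).
  assert (Hf : forall w, Cmod w < 1 -> f w = PS a w).
  { intros w Hw. eapply is_Cseries_unique; [apply is_pseries_C, Hser, Hw | now apply PS_series]. }
  assert (Hder := fun z => is_derive_PS a f z Ha Hf).
  assert (C0 : Cmod 0 < 1) by (rewrite Cmod_0; lra).
  (* [b] is the series of f' and [g] that of f / z, so [quot b g] consists of the coefficients of z
     f' / f. *)
  set (b := dcoef a). set (g := fun k => a (S k)).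
  assert (Hb : subexp b) by now apply subexp_dcoef.
  assert (Hg : subexp g) by now apply subexp_shift.
  assert (a0 : a 0%nat = 0%C) by (rewrite <- (PS_0 a Ha), <- Hf; trivial).
  assert (b0 : b 0%nat = 1%C).
  { rewrite <- (PS_0 b Hb). unfold b.
    rewrite <- (is_C_derive_unique _ _ _ (Hder 0%C C0)). now apply is_C_derive_unique. }
  assert (a1 : a 1%nat = 1%C) by (rewrite <- b0; unfold b, dcoef; simpl; ring).
  assert (Ef : forall z, Cmod z < 1 -> f z = (z * PS g z)%C).
  { intros z Hz. rewrite Hf, (PS_shift a z Ha Hz), a0; trivial. fold g. ring. }
  assert (Hg0 : forall z, Cmod z < 1 -> PS g z <> 0%C).
  (* At the origin the value is a_1 = 1; elsewhere a zero of f / z would be a zero of f. *)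
  { intros z Hz. destruct (Ceq_dec z 0) as [->|N].
    - rewrite (PS_0 g Hg). unfold g. rewrite a1. intros E. apply RtoC_inj in E. lra.
    - destruct (Hstar z Hz N) as [N' _]. rewrite Ef in N'; trivial.
      intros E. apply N'. rewrite E. ring. }
  set (A1 := PI * alpha1 / 2). set (A2 := PI * alpha2 / 2).
  assert (HA1 : 0 < A1 <= PI / 2) by (unfold A1; nra).
  assert (HA2 : 0 < A2 <= PI / 2) by (unfold A2; nra).
  assert (Hsec : forall z, Cmod z < 1 -> z <> 0%C -> sector A1 A2 (PS b z * / PS g z)%C).
  { intros z Hz N. destruct (Hstar z Hz N) as [_ K].
    destruct (K _ (Hder z Hz)) as [t [Ht Bt]].
    apply sector_of_arg with t; trivial.
    replace (PS b z * / PS g z)%C with (z * PS (dcoef a) z / f z)%C; trivial.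
    rewrite Ef; trivial. fold b. field. split; trivial. now apply Hg0. }
  assert (Hth : Rabs theta <= 1).
  { apply Rabs_le. unfold theta. split.
    - apply Rmult_le_reg_r with (alpha2 + alpha1); [lra|].
      replace ((alpha2 - alpha1) / (alpha2 + alpha1) * (alpha2 + alpha1)) with (alpha2 - alpha1)
        by (field; lra). lra.
    - apply Rmult_le_reg_r with (alpha2 + alpha1); [lra|].
      replace ((alpha2 - alpha1) / (alpha2 + alpha1) * (alpha2 + alpha1)) with (alpha2 - alpha1)
        by (field; lra). lra. }
  assert (P3 : 3 < PI) by (generalize PI2_3_2; lra).
  (* The argument gives the smaller factor [cos (PI * theta / 2)]. *)
  assert (Hcos : cos (PI * theta / 2) <= cos (theta / 2)).
  { apply cos_even_le. unfold Rdiv.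
    rewrite !Rabs_mult, (Rabs_pos_eq PI), (Rabs_pos_eq (/ 2)) by lra.
    generalize (Rabs_pos theta). nra. }
  set (B := (alpha1 + alpha2) * cos (theta / 2)).
  assert (Hq : forall n, (0 < n)%nat -> Cmod (quot b g n) <= B).
  { intros n Hn.
    (* [a1] serves as the normalisation of [g], whose constant term unfolds to [a 1]. *)
    assert (K := quot_bound A1 A2 b g HA1 HA2 Hb Hg b0 a1 Hg0 Hsec n Hn).
    replace (2 * (A1 + A2) / PI) with (alpha1 + alpha2) in K by (unfold A1, A2; field; lra).
    replace (PI * (A2 - A1) / (2 * (A1 + A2))) with (PI * theta / 2) in K
      by (unfold A1, A2, theta; field; generalize HA1 HA2; unfold A1, A2; lra).
    eapply Rle_trans; [exact K|]. apply Rmult_le_compat_l; lra. }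
  assert (HB : 0 <= B).
  (* [B] is nonnegative because it dominates the modulus of a coefficient. *)
  { eapply Rle_trans; [apply Cmod_ge_0 | apply (Hq 1%nat); lia]. }
  assert (Hrec : forall m, (quot b g m =
      INR (S m) * a (S m) - csum (fun j => quot b g j * a (S (m - j))) m)%C).
  { intros m. unfold quot at 1. rewrite remainder_eq. reflexivity. }
  assert (Main := coefficient_product_bound B a (quot b g) HB a1 b0 Hq Hrec).
  split.
  (* For m = 0 the product is empty and the denominator is 1. *)
  - generalize (Main 0%nat). simpl. unfold Rdiv. rewrite Rinv_1, !Rmult_1_r. trivial.
  - intros n Hn. destruct n as [|[|m]]; [lia | lia |].
    replace (S (S m) - 1)%nat with (S m) by lia. replace (S (S m) - 2)%nat with m by lia.
    eapply Rle_trans; [apply Main|]. right.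
    rewrite (prod_from_ext (fun k => 1 + B / INR (k - 1))
      (fun k => 1 + (alpha1 + alpha2) / INR (k - 1) * cos (theta / 2))).
    + unfold B, Rdiv. ring.
    + intros i. unfold B, Rdiv. ring.
Qed.
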